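(* Let $(d_n)_{n\ge0}$ be a strictly increasing sequence of natural numbers such that $d_n$ is odd for infinitely many $n$, and set $k_n=d_{n+1}-d_n$. For every $n\ge0$ let $D_n\le\mathrm{SL}(k_n,\mathbb{Q})$ be a finite subgroup. Let $G=\langle\mathrm{SL}(\infty,\mathbb{Q})\cup\prod_{n\ge0}D_n\rangle$, equipped with the group topology for which the inclusion of $\prod_{n\ge0}D_n$ (with the product topology) is continuous and open. Then, for every choice of $(D_n)$, the group $G$ has no non-trivial IRS's.
   Context: $\mathbb{Q}^{(\mathbb{N})}$ is the $\mathbb{Q}$-vector space with basis $(e_i)_{i\in\mathbb{N}}$, indexed by $i\ge1$. $\mathrm{SL}(\infty,\mathbb{Q})=\varinjlim_d\mathrm{SL}(d,\mathbb{Q})$ is the group of linear automorphisms of $\mathbb{Q}^{(\mathbb{N})}$ that fix all but finitely many $e_i$ and have determinant one, where $\mathrm{SL}(d,\mathbb{Q})$ acts on the span of $e_1,\dots,e_d$ and fixes the other $e_i$. The group $\prod_{n\ge0}D_n$ is viewed as a group of block-diagonal linear transformations of $\mathbb{Q}^{(\mathbb{N})}$, where $D_n$ acts on the span of $e_{d_n+1},\dots,e_{d_{n+1}}$ and fixes all other basis vectors. The resulting $G$ is a second countable locally compact group. $\mathrm{Sub}(G)$ is the compact metrisable space of closed subgroups of $G$ with the Chabauty topology (sub-basis: $\{H: H\cap V\neq\varnothing\}$ for $V$ relatively compact open, $\{H: H\cap C=\varnothing\}$ for $C$ compact), with $G$ acting by conjugation. An IRS of $G$ is a conjugation-invariant Borel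 probability measure on $\mathrm{Sub}(G)$; $G$ has no non-trivial IRS's if every IRS of $G$ is a convex combination of the Dirac masses $\delta_{\{1\}}$ and $\delta_G$. *)

(* Defs.v *)
From HB Require Import structures.
From mathcomp Require Import all_boot all_order all_algebra.
From mathcomp Require Import all_classical all_reals all_analysis.
Set Implicit Arguments.
Unset Strict Implicit.
Unset Printing Implicit Defensive.
Import Order.TTheory GRing.Theory Num.Theory.
Local Open Scope classical_set_scope.
Local Open Scope ring_scope.

(* The Q-vector space Q^(N) is modelled by {poly rat}, its basis being the
   monomials; indices start at 0, so that the e_{i+1} of a 1-based indexing is
   e_ i below.  Only the vector space structure of {poly rat} is used. *)
Notation Qinf := {poly rat}.
Definition e_ (i : nat) : Qinf := 'X^i.

(* The group of all linear automorphisms of Q^(N), under composition. *)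
Record GLinf := GLInf {
  glfun :> Qinf -> Qinf;
  glfunP : linear glfun /\ bijective glfun }.

HB.instance Definition _ := gen_eqMixin GLinf.
HB.instance Definition _ := gen_choiceMixin GLinf.

Lemma glP (f g : GLinf) : f =1 g -> f = g.
Proof.
case: f g => f Hf [g Hg] /= /funext fg; subst g; congr GLInf.
exact: Prop_irrelevance.
Qed.

Lemma gl1_subproof : linear (@id Qinf) /\ bijective (@id Qinf).
Proof. by split=> //; exists id. Qed.
Definition gl1 := GLInf gl1_subproof.

Lemma glM_subproof (f g : GLinf) : linear (f \o g) /\ bijective (f \o g).
Proof.
have [Lf Bf] := glfunP f; have [Lg Bg] := glfunP g; split; last exact: bij_comp.
by move=> a u v /=; rewrite Lg Lf.
Qed.
Definition glM f g := GLInf (glM_subproof f g).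

Lemma glV_ex (f : GLinf) : {g : GLinf | cancel f g /\ cancel g f}.
Proof.
apply: cid; have [Lf Bf] := glfunP f; have [g fK gK] := Bf.
have Hg : linear g /\ bijective g.
  split; last by exists f.
  by move=> a u v; apply: (bij_inj Bf); rewrite Lf !gK.
by exists (GLInf Hg).
Qed.
Definition glV f := sval (glV_ex f).

Lemma glMA : associative glM. Proof. by move=> f g h; apply: glP. Qed.
Lemma gl1M : left_id gl1 glM. Proof. by move=> f; apply: glP. Qed.
Lemma glM1 : right_id gl1 glM. Proof. by move=> f; apply: glP. Qed.
Lemma glVM : left_inverse gl1 glV glM.
Proof. by move=> f; apply: glP => v /=; apply: (svalP (glV_ex f)).1. Qed.
Lemma glMV : right_inverse gl1 glV glM.
Proof. by move=> f; apply: glP => v /=; apply: (svalP (glV_ex f)).2. Qed.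

HB.instance Definition _ := isGroup.Build GLinf glMA gl1M glM1 glVM glMV.

Definition linext (f : nat -> Qinf) (v : Qinf) : Qinf :=
  \sum_(i < size v) v`_i *: f i.

(* The value at e_i of the endomorphism that acts by A (on column vectors) on
   the span of e_m, ..., e_{m+k-1} and fixes the other basis vectors. *)
Definition block_op (m k : nat) (A : 'M[rat]_k) (i : nat) : Qinf :=
  if (m <= i)%N then
    if insub (i - m)%N is Some j then \sum_(l < k) A l j *: e_ (m + l) else e_ i
  else e_ i.

(* The union over n of the images of SL(n, Q). *)
Definition SLinf : set GLinf :=
  [set g : GLinf | exists n (A : 'M[rat]_n),
     \det A = 1 /\ forall i, g (e_ i) = block_op 0 A i].

Record finite_SL_subgroup (k : nat) := FiniteSLSubgroup {
  fsl_set :> set 'M[rat]_k;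
  fsl_det : forall A, fsl_set A -> \det A = 1;
  fsl1 : fsl_set 1%:M;
  fslM : forall A B, fsl_set A -> fsl_set B -> fsl_set (A *m B);
  fslV : forall A, fsl_set A -> fsl_set (invmx A);
  fsl_finite : finite_set fsl_set }.

Lemma linextE f (v : Qinf) n : (size v <= n)%N -> linext f v = \sum_(i < n) v`_i *: f i.
Proof.
move=> vn; rewrite /linext (big_ord_widen n (fun i => v`_i *: f i) vn).
rewrite big_mkcond /=; apply: eq_bigr => i _; case: ltnP => // iv.
by rewrite nth_default// scale0r.
Qed.

Lemma linext_is_linear f : linear (linext f).
Proof.
move=> a u v; pose n := maxn (size u) (size v).
have un : (size u <= n)%N by exact: leq_maxl.
have vn : (size v <= n)%N by exact: leq_maxr.
have uvn : (size (a *: u + v)%R <= n)%N.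
  by rewrite (leq_trans (size_polyD _ _))// geq_max vn (leq_trans (size_scale_leq _ _)).
rewrite (linextE _ un) (linextE _ vn) (linextE _ uvn) scaler_sumr -big_split /=.
by apply: eq_bigr => i _; rewrite coefD coefZ scalerDl scalerA.
Qed.

HB.instance Definition _ f :=
  GRing.isLinear.Build rat {poly rat} {poly rat} _ (linext f) (linext_is_linear f).

Lemma linext_e f i : linext f (e_ i) = f i.
Proof.
rewrite (@linextE _ _ i.+1) ?size_polyXn// (bigD1 ord_max)//= coefXn eqxx scale1r.
rewrite big1 ?addr0// => j; rewrite -val_eqE /= => ji.
by rewrite coefXn (negbTE ji) scale0r.
Qed.

Lemma linear_eq_basis (f g : Qinf -> Qinf) : linear f -> linear g ->
  (forall i, f (e_ i) = g (e_ i)) -> f =1 g.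
Proof.
move=> Lf Lg fg v.
pose F := GRing.isLinear.Build rat {poly rat} {poly rat} _ f Lf.
pose G := GRing.isLinear.Build rat {poly rat} {poly rat} _ g Lg.
pose f' : {linear {poly rat} -> {poly rat}} := HB.pack f F.
pose g' : {linear {poly rat} -> {poly rat}} := HB.pack g G.
rewrite -[v]coefK poly_def -[f]/(f' : _ -> _) -[g]/(g' : _ -> _) !linear_sum.
by apply: eq_bigr => i _; rewrite !linearZ /= fg.
Qed.

Lemma block_op_in m k (A : 'M[rat]_k) (j : 'I_k) :
  block_op m A (m + j) = \sum_(l < k) A l j *: e_ (m + l).
Proof.
rewrite /block_op leq_addr addKn insubT //= => lt.
by rewrite (_ : Sub _ _ = j) //; exact: val_inj.
Qed.

Lemma block_op_out m k (A : 'M[rat]_k) i :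
  ~~ (m <= i < m + k)%N -> block_op m A i = e_ i.
Proof.
rewrite /block_op; have [mi /=|//] := leqP m i; rewrite -leqNgt => ki.
by rewrite insubF//; apply/negbTE; rewrite -leqNgt leq_subRL.
Qed.

Lemma coef_block m k (A : 'M[rat]_k) (i j : 'I_k) :
  (\sum_(l < k) A l j *: e_ (m + l))`_(m + i) = A i j.
Proof.
rewrite coef_sum (bigD1 i)//= coefZ coefXn eqxx mulr1 big1 ?addr0// => l li.
by rewrite coefZ coefXn eqn_add2l eq_sym val_eqE (negbTE li) mulr0.
Qed.

Section BlockDiagonal.
Variables (d : nat -> nat) (d_incr : {homo d : m n / (m < n)%N}).

(* A block that contains i has index at most i, since d is increasing: the
   search over 'I_i.+1 fails exactly when i < d 0. *)
Definition blockdiag_op (x : forall n, 'M[rat]_(d n.+1 - d n)) (i : nat) :=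
  if [pick n : 'I_i.+1 | d n <= i < d n.+1]%N is Some n
  then block_op (d n) (x n) i else e_ i.

Lemma d_le m n : (m <= n)%N -> (d m <= d n)%N.
Proof. by rewrite leq_eqVlt => /orP[/eqP->//|/d_incr/ltnW]. Qed.

Lemma d_ge n : (n <= d n)%N.
Proof. by elim: n => // n /leq_ltn_trans; apply; apply: d_incr. Qed.

Lemma block_uniq m n i :
  (d m <= i < d m.+1)%N -> (d n <= i < d n.+1)%N -> m = n.
Proof.
move=> /andP[mi im] /andP[ni inn]; apply/eqP; rewrite eqn_leq.
apply/andP; split; rewrite -ltnS ltnNge; apply/negP.
- by move=> /d_le nm; have := leq_ltn_trans (leq_trans nm mi) inn; rewrite ltnn.
- by move=> /d_le nm; have := leq_ltn_trans (leq_trans nm ni) im; rewrite ltnn.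
Qed.

Lemma blockdiag_in x n (j : 'I_(d n.+1 - d n)) :
  blockdiag_op x (d n + j) = \sum_l x n l j *: e_ (d n + l).
Proof.
have jn : (d n <= d n + j < d n.+1)%N by rewrite leq_addr -ltn_subRL /=.
have ns : (n < (d n + j).+1)%N by rewrite ltnS (leq_trans (d_ge n))// leq_addr.
rewrite /blockdiag_op; case: pickP => [m /= mi|/(_ (Ordinal ns)) /=]; last first.
  by rewrite jn.
by have := block_uniq mi jn; move: (nat_of_ord m) mi => m' _ ->; rewrite block_op_in.
Qed.

Lemma blockdiag_cases i :
  (exists n (j : 'I_(d n.+1 - d n)), i = (d n + j)%N) \/
  (i < d 0 /\ forall x, blockdiag_op x i = e_ i)%N.
Proof.
have [i0|i0] := ltnP i (d 0).
  right; split=> // x; rewrite /blockdiag_op; case: pickP => // n /andP[ni _].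
  by have := leq_trans i0 (leq_trans (d_le (leq0n n)) ni); rewrite ltnn.
left; have [n] : exists n, (d n <= i < d n.+1)%N.
  have ex : exists n, (i < d n)%N by exists i.+1; apply: d_ge.
  case: (ex_minnP ex) => -[|n] im mn; first by move: im; rewrite ltnNge i0.
  exists n; rewrite im andbT leqNgt; apply/negP => /mn; by rewrite ltnn.
move=> /andP[ni inn]; have lt : (i - d n < d n.+1 - d n)%N by rewrite ltn_sub2r// d_incr.
by exists n, (Ordinal lt); rewrite /= subnKC.
Qed.

Lemma blockdiag1 : linext (blockdiag_op (fun=> 1%:M)) =1 id.
Proof.
apply: linear_eq_basis => //; first exact: linext_is_linear.
move=> i; rewrite linext_e; case: (blockdiag_cases i) => [[n [j ->]]|[_ ->//]].
rewrite blockdiag_in (bigD1 j)//= mxE eqxx scale1r big1 ?addr0// => l lj.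
by rewrite mxE (negbTE lj) scale0r.
Qed.

Lemma blockdiagM x y : linext (blockdiag_op (fun n => x n *m y n)) =1
  linext (blockdiag_op x) \o linext (blockdiag_op y).
Proof.
apply: linear_eq_basis; first exact: linext_is_linear.
  by move=> a u v /=; rewrite !linearP.
move=> i /=; rewrite !linext_e.
case: (blockdiag_cases i) => [[n [j ->]]|[_ E]]; last by rewrite !E linext_e E.
rewrite !blockdiag_in linear_sum /=.
under [RHS]eq_bigr do rewrite linearZ /= linext_e blockdiag_in scaler_sumr.
rewrite exchange_big /=; apply: eq_bigr => l _; rewrite mxE scaler_suml.
by apply: eq_bigr => h _; rewrite scalerA mulrC.
Qed.

End BlockDiagonal.

Local Open Scope group_scope.

Section BlockProduct.
Variables (d : nat -> nat) (d_incr : {homo d : m n / (m < n)%N}).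
Variable D : forall n, finite_SL_subgroup (d n.+1 - d n).

(* The product of the discrete groups D n, with the product topology. *)
Definition block_prod :=
  prod_topology (fun n => discrete_topology (set_type (D n))).

HB.instance Definition _ := Topological.on block_prod.

Definition bp_mx (x : block_prod) n : 'M[rat]_(d n.+1 - d n) := set_val (x n).

Lemma bp_mxP x n : fsl_set (D n) (bp_mx x n).
Proof. exact: set_valP. Qed.

Definition bp_mk (A : forall n, 'M[rat]_(d n.+1 - d n)) (HA : forall n, fsl_set (D n) (A n)) :
  block_prod := fun n => SigSub (mem_set (HA n)).

Lemma bp_mkK A HA n : bp_mx (@bp_mk A HA) n = A n. Proof. by []. Qed.

Lemma bp_eq (x y : block_prod) : bp_mx x = bp_mx y -> x = y.
Proof.
move=> xy; apply: functional_extensionality_dep => n.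
by apply: val_inj; exact: (congr1 (fun f => f n) xy).
Qed.

Definition bp1 := bp_mk (fun n => fsl1 (D n)).
Definition bpM x y := bp_mk (fun n => fslM (bp_mxP x n) (bp_mxP y n)).
Definition bpV x := bp_mk (fun n => fslV (bp_mxP x n)).

Lemma bp_unit x n : bp_mx x n \in unitmx.
Proof. by rewrite unitmxE (fsl_det (bp_mxP x n)) unitr1. Qed.

Lemma bpMA : associative bpM.
Proof.
move=> x y z; apply: bp_eq; apply: functional_extensionality_dep => n /=.
by rewrite !bp_mkK mulmxA.
Qed.
Lemma bp1M : left_id bp1 bpM.
Proof.
move=> x; apply: bp_eq; apply: functional_extensionality_dep => n /=.
by rewrite !bp_mkK mul1mx.
Qed.
Lemma bpM1 : right_id bp1 bpM.
Proof.
move=> x; apply: bp_eq; apply: functional_extensionality_dep => n /=.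
by rewrite !bp_mkK mulmx1.
Qed.
Lemma bpVM : left_inverse bp1 bpV bpM.
Proof.
move=> x; apply: bp_eq; apply: functional_extensionality_dep => n /=.
by rewrite !bp_mkK mulVmx// bp_unit.
Qed.
Lemma bpMV : right_inverse bp1 bpV bpM.
Proof.
move=> x; apply: bp_eq; apply: functional_extensionality_dep => n /=.
by rewrite !bp_mkK mulmxV// bp_unit.
Qed.

HB.instance Definition _ := isGroup.Build block_prod bpMA bp1M bpM1 bpVM bpMV.

Lemma blockdiag_subproof (x : block_prod) :
  linear (linext (blockdiag_op (bp_mx x))) /\ bijective (linext (blockdiag_op (bp_mx x))).
Proof.
split; first exact: linext_is_linear.
have K (y z : block_prod) : y * z = 1 ->
    linext (blockdiag_op (bp_mx y)) \o linext (blockdiag_op (bp_mx z)) =1 id.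
  move=> yz v; rewrite -(blockdiagM d_incr) -[RHS](blockdiag1 d_incr).
  exact: (congr1 (fun w => linext (blockdiag_op (bp_mx w)) v) yz).
exists (linext (blockdiag_op (bp_mx x^-1))).
- by move=> v; apply: (K _ _ (mulVg x)).
- by move=> v; apply: (K _ _ (mulgV x)).
Qed.

Definition blockdiag (x : block_prod) : GLinf := GLInf (blockdiag_subproof x).

Lemma blockdiag_mul x y : blockdiag (x * y) = blockdiag x * blockdiag y.
Proof. by apply: glP => v /=; rewrite -[RHS](blockdiagM d_incr). Qed.

Lemma blockdiag_one : blockdiag 1 = 1.
Proof. by apply: glP => v /=; rewrite -[RHS](blockdiag1 d_incr). Qed.

Lemma blockdiag_inv x : blockdiag x^-1 = (blockdiag x)^-1.
Proof. by apply: (mulgI (blockdiag x)); rewrite -blockdiag_mul !mulgV blockdiag_one. Qed.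

Lemma blockdiag_inj : injective blockdiag.
Proof.
move=> x y /(congr1 glfun) /= xy; apply: bp_eq.
apply: functional_extensionality_dep => n; apply/matrixP => l j.
have := congr1 (fun f : Qinf -> Qinf => ((f (e_ (d n + j)))`_(d n + l)%N)%R) xy.
by rewrite !linext_e !(blockdiag_in d_incr) !coef_block.
Qed.

Definition generated (A : set GLinf) : set GLinf :=
  smallest [set H : set GLinf | group_closed (mem H)] A.

Lemma generated_closed A : group_closed (mem (generated A)).
Proof.
split; first by rewrite in_setE => H [[+ _] _]; rewrite in_setE.
move=> x y; rewrite !in_setE => xA yA H HA.
have := HA.1.2 x y; rewrite !in_setE; apply; [exact: xA | exact: yA].
Qed.

(* The subgroup generated by SL(oo, Q) and the product of the D n. *)
Definition Gset := generated (SLinf `|` range blockdiag).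
Definition Ggroup := set_type Gset.

HB.instance Definition _ := SubChoice.on Ggroup.
HB.instance Definition _ :=
  SubChoice_isSubGroup.Build GLinf (mem Gset) Ggroup (generated_closed _).

Lemma sub_generated A : A `<=` generated A.
Proof. by move=> x Ax H [_ AH]; apply: AH. Qed.

Lemma blockdiag_Gset x : Gset (blockdiag x).
Proof. by apply: sub_generated; right; exists x. Qed.

Definition iota_prod (x : block_prod) : Ggroup := SigSub (mem_set (blockdiag_Gset x)).

(* Left translations being homeomorphisms, this is the only possible family of
   open sets for a group topology on Ggroup that makes iota_prod continuous and
   open.  That it does have these properties is proved below:
   iota_prod_continuous, iota_prod_open, G_mul_continuous, G_inv_continuous. *)
Definition G_open (U : set Ggroup) :=
  forall g : Ggroup, open [set x : block_prod | U (g * iota_prod x)].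

Lemma G_openT : G_open setT.
Proof. by move=> g; rewrite (_ : mkset _ = setT)//; exact: openT. Qed.

Lemma G_openI : setI_closed G_open.
Proof. by move=> U V oU oV g; apply: openI; [exact: oU | exact: oV]. Qed.

Lemma G_open_bigcup (I : Type) (f : I -> set Ggroup) :
  (forall i, G_open (f i)) -> G_open (\bigcup_i f i).
Proof.
move=> fo g; rewrite (_ : mkset _ = \bigcup_i [set x | f i (g * iota_prod x)])//.
by apply: bigcup_open => i _; exact: fo.
Qed.

HB.instance Definition _ :=
  isOpenTopological.Build Ggroup G_openT G_openI G_open_bigcup.

Lemma G_openE (U : set Ggroup) : open U = G_open U. Proof. by []. Qed.

(* A neighborhood base of x in block_prod, indexed by N. *)
Definition cyl (x : block_prod) N : set block_prod :=
  [set y | forall n, (n < N)%N -> bp_mx y n = bp_mx x n].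

Lemma nbhs_cyl (x : block_prod) N : nbhs x (cyl x N).
Proof.
elim: N => [|N IH]; first by apply: filterS filterT.
have HN : nbhs x (fun y : block_prod => bp_mx y N = bp_mx x N).
  have C := @proj_continuous _ (fun n => discrete_topology (set_type (D n))) N x.
  have H : nbhs x [set y : block_prod | y N = x N].
    exact: (C _ (discrete_set1 (x N : discrete_topology (set_type (D N))))).
  by apply: filterS H => y /= yx; rewrite /bp_mx yx.
apply: filterS (filterI IH HN) => y [yx yN] n; rewrite ltnS leq_eqVlt.
by case/orP => [/eqP->//|/yx].
Qed.

Lemma nbhs_bpP (x : block_prod) W : nbhs x W <-> exists N, cyl x N `<=` W.
Proof.
split=> [xW|[N]]; last by move/filterS; apply; exact: nbhs_cyl.
pose F := filter_from [set: nat] (cyl x).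
have FF : Filter F.
  apply: filter_from_filter; first by exists 0%N.
  move=> i j _ _; exists (maxn i j) => // y yx; split=> n ni; apply: yx.
    by rewrite leq_max ni.
  by rewrite leq_max ni orbT.
suff /(_ W xW) [N _ NW] : F --> x by exists N.
apply/cvg_sup => i U [V] [[B] oB <-] Bx BU; exists i.+1 => // y yx; apply: BU => /=.
suff -> : y i = x i by [].
by apply: val_inj; apply: yx.
Qed.

Lemma open_bpP (W : set block_prod) :
  open W <-> forall x, W x -> exists N, cyl x N `<=` W.
Proof. by rewrite openE; split=> oW x /oW; rewrite /interior => /nbhs_bpP. Qed.

Lemma bp_mxM x y n : bp_mx (x * y) n = bp_mx x n *m bp_mx y n.
Proof. by []. Qed.

Lemma bp_mulL c (W : set block_prod) : open W -> open [set x | W (c * x)].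
Proof.
move=> /open_bpP oW; apply/open_bpP => x /= /oW[N NW]; exists N => y yx /=.
by apply: NW => n nN; rewrite !bp_mxM yx.
Qed.

Lemma bp_mulR c (W : set block_prod) : open W -> open [set x | W (x * c)].
Proof.
move=> /open_bpP oW; apply/open_bpP => x /= /oW[N NW]; exists N => y yx /=.
by apply: NW => n nN; rewrite !bp_mxM yx.
Qed.

Lemma iota_prodM x y : iota_prod (x * y) = iota_prod x * iota_prod y.
Proof. by apply: val_inj; rewrite /= blockdiag_mul. Qed.

Lemma iota_prod1 : iota_prod 1 = 1.
Proof. by apply: val_inj; rewrite /= blockdiag_one. Qed.

Lemma iota_prodV x : iota_prod x^-1 = (iota_prod x)^-1.
Proof. by apply: (mulgI (iota_prod x)); rewrite -iota_prodM !mulgV iota_prod1. Qed.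

Lemma iota_prod_inj : injective iota_prod.
Proof. by move=> x y /(congr1 val) /blockdiag_inj. Qed.

Lemma iota_prod_continuous : continuous iota_prod.
Proof.
apply/continuousP => U; rewrite G_openE => /(_ 1).
by congr open; apply/funext => x /=; rewrite mul1g.
Qed.

Lemma iota_prod_open (W : set block_prod) : open W -> open (iota_prod @` W).
Proof.
move=> oW; rewrite G_openE => g.
have [[x0 [w0 Ww0 E]]|none] := pselect (exists x, (iota_prod @` W) (g * iota_prod x)).
  have -> : g = iota_prod (w0 * x0^-1) by rewrite iota_prodM iota_prodV E mulgK.
  suff -> : [set x | (iota_prod @` W) (iota_prod (w0 * x0^-1) * iota_prod x)] =
      [set x | W (w0 * x0^-1 * x)] by exact: bp_mulL.
  apply/funext => x /=; apply/propext; rewrite -iota_prodM; split.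
    by move=> [w Ww /iota_prod_inj <-].
  by move=> Wx; eexists; first exact: Wx.
rewrite (_ : mkset _ = set0); first exact: open0.
by rewrite -subset0 => x /= xW; apply: none; exists x.
Qed.

Lemma G_mulL g (U : set Ggroup) : open U -> open [set x | U (g * x)].
Proof.
rewrite !G_openE => oU h; have := oU (g * h).
by congr open; apply/funext => x /=; rewrite mulgA.
Qed.

Definition rcont (h : Ggroup) :=
  forall U : set Ggroup, open U -> open [set x | U (x * h)].

Lemma rcontM g h : rcont g -> rcont h -> rcont (g * h).
Proof.
move=> rg rh U /rh /rg; congr open.
by apply/funext => x /=; rewrite mulgA.
Qed.

Lemma rcont_iota c : rcont (iota_prod c).
Proof.
move=> U; rewrite !G_openE => oU g; have := bp_mulR c (oU g); congr open.
by apply/funext => x /=; rewrite iota_prodM mulgA.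
Qed.

Lemma rcont_commute (h : Ggroup) N :
  (forall q, cyl 1 N q -> iota_prod q * h = h * iota_prod q) -> rcont h.
Proof.
move=> comm U; rewrite !G_openE => oU g; apply/open_bpP => p /= Up.
have /open_bpP/(_ 1) := oU (g * iota_prod p * h).
rewrite /= iota_prod1 mulg1 => /(_ Up)[M MU].
exists (maxn N M) => y yp /=.
have yE n : (n < maxn N M)%N -> bp_mx (p^-1 * y) n = bp_mx (1 : block_prod) n.
  move=> nN; have := congr1 (fun z => bp_mx z n) (mulVg p).
  by rewrite !bp_mxM yp.
have -> : g * iota_prod y * h = g * iota_prod p * h * iota_prod (p^-1 * y).
  rewrite -[RHS]mulgA -comm.
    by rewrite iota_prodM iota_prodV !mulgA mulgK.
  by move=> n nN; apply: yE; rewrite leq_max nN.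
by apply: MU => n nN; apply: yE; rewrite leq_max nN orbT.
Qed.

Lemma SLinf_commute (h : Ggroup) : SLinf (val h) ->
  exists N, forall q, cyl 1 N q -> iota_prod q * h = h * iota_prod q.
Proof.
move=> [m [A [_ hA]]]; exists m => q q1; apply: val_inj; apply: glP.
have qlow i : (i < m)%N -> val (iota_prod q) (e_ i) = e_ i.
  move=> im /=; rewrite linext_e; case: (blockdiag_cases d_incr i) => [[n [j iE]]|[_ ->//]].
  rewrite iE (blockdiag_in d_incr) q1.
    by rewrite -(blockdiag_in d_incr (bp_mx (1 : block_prod)))
    -(linext_e (blockdiag_op _)) (blockdiag1 d_incr).
  by rewrite (leq_ltn_trans _ im)// iE (leq_trans (d_ge d_incr n))// leq_addr.
have Lh := (glfunP (val h)).1; have Lq := (glfunP (val (iota_prod q))).1.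
have linsum (f : GLinf) (I : finType) (F : I -> Qinf) (c : I -> rat) :
    f (\sum_l c l *: F l)%R = (\sum_l c l *: f (F l))%R.
  have [Lf _] := glfunP f.
  pose f' : {linear {poly rat} -> {poly rat}} := HB.pack (glfun f)
    (GRing.isLinear.Build rat {poly rat} {poly rat} _ (glfun f) Lf).
  rewrite -[glfun f]/(f' : _ -> _) linear_sum.
  by apply: eq_bigr => l _; rewrite linearZ.
apply: linear_eq_basis; [exact: (glfunP _).1 | exact: (glfunP _).1|].
move=> i; change (val (iota_prod q) (val h (e_ i)) = val h (val (iota_prod q) (e_ i))).
have [im|mi] := ltnP i m.
  rewrite (qlow _ im) hA; pose j := Ordinal im.
  rewrite (_ : i = (0 + j)%N)// block_op_in linsum.
  by apply: eq_bigr => l _; rewrite qlow//; exact: ltn_ord.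
have hhigh l : (m <= l)%N -> val h (e_ l) = e_ l.
  by move=> ml; rewrite hA block_op_out// -leqNgt.
rewrite (hhigh _ mi) /= linext_e.
case: (blockdiag_cases d_incr i) => [[n [j iE]]|[_ ->]]; last by rewrite hhigh.
have [nm|mn] := ltnP n m.
  have := q1 _ nm => qn.
  have -> : blockdiag_op (bp_mx q) i = e_ i; last by rewrite hhigh.
  rewrite iE (blockdiag_in d_incr) qn.
  by rewrite -(blockdiag_in d_incr (bp_mx (1 : block_prod)))
    -(linext_e (blockdiag_op _)) (blockdiag1 d_incr).
rewrite iE (blockdiag_in d_incr) linsum; apply: eq_bigr => l _; rewrite hhigh//.
by rewrite (leq_trans mn)// (leq_trans (d_ge d_incr n))// leq_addr.
Qed.

Lemma rcontG h : rcont h.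
Proof.
pose M : set GLinf := [set g | exists h : Ggroup,
  [/\ val h = g, rcont h & rcont h^-1]].
have MG : group_closed (mem M).
  split; first by rewrite in_setE; exists 1; rewrite invg1; split=> // U;
    congr open; apply/funext => x /=; rewrite mulg1.
  move=> g1 g2; rewrite !in_setE => -[h1 [<- r1 r1']] [h2 [<- r2 r2']].
  exists (h1 * h2^-1); split=> //; first exact: rcontM.
  by rewrite invgM invgK; apply: rcontM.
have AM : SLinf `|` range blockdiag `<=` M.
  have GS g : (SLinf `|` range blockdiag) g -> Gset g by exact: sub_generated.
  move=> g Ag; pose k : Ggroup := SigSub (mem_set (GS g Ag)); exists k.
  have kg : val k = g by [].
  move: k kg => {GS} k kg; case: Ag => [SLg|[x _ xg]].
    rewrite -kg in SLg; have [N HN] := SLinf_commute SLg.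
    split=> //; apply: (@rcont_commute _ N) => // q /HN qk.
    by apply: (mulgI k); rewrite mulgA -qk mulgK mulVKg.
  have kE : k = iota_prod x by apply: val_inj; rewrite kg.
  by split=> //; rewrite kE -?iota_prodV; exact: rcont_iota.
have [k [/val_inj-> //]] : M (val h) by apply: (set_valP h); split.
Qed.

Lemma G_nbhs (g : Ggroup) (U : set Ggroup) : nbhs g U ->
  exists N, forall q, cyl 1 N q -> U (g * iota_prod q).
Proof.
rewrite nbhsE => -[V [oV Vg] VU].
have /open_bpP/(_ 1) := (oV : G_open V) g; rewrite /= iota_prod1 mulg1 => /(_ Vg)[N NV].
by exists N => q qN; apply: VU; apply: NV.
Qed.

Lemma cyl1M N x y : cyl 1 N x -> cyl 1 N y -> cyl 1 N (x * y).
Proof. by move=> x1 y1 n nN; rewrite bp_mxM x1// y1// -bp_mxM mulg1. Qed.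

Lemma cyl1V N x : cyl 1 N x -> cyl 1 N x^-1.
Proof.
move=> x1 n nN; have := congr1 (fun z => bp_mx z n) (mulVg x).
by rewrite bp_mxM x1// -bp_mxM mulg1.
Qed.

Definition coset_nbhs (g h : Ggroup) N : set Ggroup :=
  [set x | exists2 q, cyl 1 N q & g * x * h = iota_prod q].

Lemma open_coset g h N : open (coset_nbhs g h N).
Proof.
have /iota_prod_open/(@G_mulL g)/(@rcontG h) : open (cyl 1 N).
  apply/open_bpP => x x1; exists N => y yx n nN; by rewrite yx// x1.
congr open; apply/funext => x /=; apply/propext.
by split=> -[q q1 E]; exists q => //; rewrite ?E ?mulgA// -E mulgA.
Qed.

Lemma nbhs_coset (g h : Ggroup) N : nbhs (g^-1 * h^-1 : Ggroup) (coset_nbhs g h N).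
Proof.
apply: open_nbhs_nbhs; split; first exact: open_coset.
by exists 1 => //; rewrite iota_prod1 mulVKg mulVg.
Qed.

Lemma G_mul_continuous : continuous (fun xy : Ggroup * Ggroup => xy.1 * xy.2).
Proof.
move=> [g h] U /= /G_nbhs[N NU].
exists (coset_nbhs (h^-1 * g^-1) h N, coset_nbhs h^-1 1 N).
  split=> /=.
    by have := nbhs_coset (h^-1 * g^-1) h N; rewrite invgM !invgK mulgK.
  by have := nbhs_coset h^-1 1 N; rewrite invgK invg1 mulg1.
move=> [x y] /= [[p p1 px] [q q1 qy]] /=.
have := NU _ (cyl1M p1 q1); rewrite iota_prodM -px -qy.
by rewrite /= mulg1 !mulgA !mulgK mulgV mul1g.
Qed.

Lemma G_inv_continuous : continuous (fun x : Ggroup => x^-1).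
Proof.
move=> g U /= /G_nbhs[N NU].
have := nbhs_coset 1 g^-1 N; rewrite invgK invg1 mul1g => H; apply: filterS H => x [p p1 px].
by have := NU _ (cyl1V p1); rewrite iota_prodV -px /= mul1g invgM invgK mulKg.
Qed.

Lemma G_hausdorff : hausdorff_space Ggroup.
Proof.
rewrite open_hausdorff => g h gh.
have [N HN] : exists N, forall q, cyl 1 N q -> g^-1 * h <> iota_prod q.
  have [[p pE]|none] := pselect (exists p, g^-1 * h = iota_prod p); last first.
    by exists 0%N => q _ qE; apply: none; exists q.
  have p1 : p <> 1.
    by move=> p1; move: gh; rewrite -(mulVKg g h) pE p1 iota_prod1 mulg1 eqxx.
  have /existsNP[n np] : ~ forall n, bp_mx p n = bp_mx (1 : block_prod) n.
    by move=> pn; apply: p1; apply: bp_eq; apply: functional_extensionality_dep.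
  exists n.+1 => q qn; rewrite pE => /iota_prod_inj pq; apply: np.
  by rewrite pq qn.
exists (coset_nbhs g^-1 1 N, coset_nbhs h^-1 1 N); split=> /=.
- by rewrite inE; exists 1 => //; rewrite mulVg mulg1 iota_prod1.
- by rewrite inE; exists 1 => //; rewrite mulVg mulg1 iota_prod1.
- exact: open_coset.
- exact: open_coset.
apply/eqP; rewrite -subset0 => x /= [[p p1 px] [q q1 qx]].
apply: (HN _ (cyl1M p1 (cyl1V q1))).
by rewrite iota_prodM iota_prodV -px -qx !mulg1 invgM invgK mulgA mulgK.
Qed.

End BlockProduct.

HB.mixin Record isTopologicalGroup G of Group G & Topological G := {
  mulg_continuous : continuous (fun xy : G * G => xy.1 * xy.2);
  invg_continuous : continuous (fun x : G => x^-1);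
  topgroup_hausdorff : hausdorff_space G }.

#[short(type="topologicalGroupType")]
HB.structure Definition TopologicalGroup :=
  {G of Group G & Topological G & isTopologicalGroup G}.

Section Chabauty.
Variable G : topologicalGroupType.

Record closed_subgroup := ClosedSubgroup {
  csg_set :> set G;
  csg_group : group_closed (mem csg_set);
  csg_closed : closed csg_set }.

Lemma csgP (H K : closed_subgroup) : (H : set G) = K -> H = K.
Proof.
case: H K => H gH cH [K gK cK] /= HK; subst K.
by congr ClosedSubgroup; exact: Prop_irrelevance.
Qed.

Lemma csg_trivial_subproof :
  group_closed (mem [set 1 : G]) /\ closed [set 1 : G].
Proof.
split; last exact/accessible_closed_set1/hausdorff_accessible/topgroup_hausdorff.
split; first by rewrite in_setE.
by move=> x y; rewrite !in_setE /= => -> ->; rewrite mulgV.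
Qed.

Definition csg_trivial :=
  ClosedSubgroup csg_trivial_subproof.1 csg_trivial_subproof.2.

Lemma csg_full_subproof : group_closed (mem [set: G]).
Proof. by split=> [|x y]; rewrite !in_setE. Qed.

Definition csg_full := ClosedSubgroup csg_full_subproof closedT.

Lemma csg_conj_subproof (g : G) (H : closed_subgroup) :
  let K := [set g * h * g^-1 | h in H] in group_closed (mem K) /\ closed K.
Proof.
move=> K; split.
  have [H1 HV] := csg_group H; split.
    by rewrite in_setE; exists 1; [exact: set_mem H1 | rewrite mulg1 mulgV].
  move=> x y; rewrite !in_setE => -[h Hh <-] [k Hk <-].
  exists (h * k^-1); first exact/set_mem/HV/mem_set/Hk/mem_set/Hh.
  by rewrite !invgM invgK !mulgA mulgVK.
have -> : K = (fun x => g^-1 * x * g) @^-1` H.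
  apply/seteqP; split=> x /=; first by move=> [h Hh <-]; rewrite !mulgA mulgVK mulVg mul1g.
  by move=> Hx; exists (g^-1 * x * g) => //; rewrite !mulgA mulgK mulgV mul1g.
have mulC (a : G) : continuous (fun x : G => a * x) /\ continuous (fun x : G => x * a).
  split=> x.
    apply: (@continuous_comp _ _ _ (fun x : G => (a, x)) (fun xy : G * G => xy.1 * xy.2)).
      by apply: cvg_pair; [exact: cvg_cst | exact: cvg_id].
    exact: mulg_continuous.
  apply: (@continuous_comp _ _ _ (fun x : G => (x, a)) (fun xy : G * G => xy.1 * xy.2)).
    by apply: cvg_pair; [exact: cvg_id | exact: cvg_cst].
  exact: mulg_continuous.
apply: preimage_closed; last exact: csg_closed.
move=> x _; apply: (@continuous_comp _ _ _ (fun x : G => g^-1 * x) (fun x => x * g)).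
  exact: (mulC g^-1).1.
exact: (mulC g).2.
Qed.

Definition csg_conj (g : G) (H : closed_subgroup) :=
  ClosedSubgroup (csg_conj_subproof g H).1 (csg_conj_subproof g H).2.

HB.instance Definition _ := gen_eqMixin closed_subgroup.
HB.instance Definition _ := gen_choiceMixin closed_subgroup.
HB.instance Definition _ := isPointed.Build closed_subgroup csg_trivial.

Definition chabauty_subbase : set (set closed_subgroup) :=
  [set [set H : closed_subgroup | H `&` V !=set0] |
     V in [set V : set G | open V /\ precompact V]] `|`
  [set [set H : closed_subgroup | H `&` C = set0] |
     C in [set C : set G | compact C]].

HB.instance Definition _ := @isSubBaseTopological.Build closed_subgroup
  (set closed_subgroup) chabauty_subbase id.

(* The space of closed subgroups with the Borel sigma-algebra of the Chabauty
   topology. *)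
Definition SubG : measurableType (@open closed_subgroup).-sigma :=
  g_sigma_algebraType (@open closed_subgroup).

Variable R : realType.

Definition is_IRS (mu : probability SubG R) :=
  forall (g : G) (A : set SubG), measurable A -> mu (csg_conj g @^-1` A) = mu A.

Definition no_nontrivial_IRS :=
  forall mu : probability SubG R, is_IRS mu ->
  exists2 p : R, (0 <= p <= 1)%R & forall A : set SubG, measurable A ->
    mu A = (p%:E * dirac (csg_trivial : SubG) A +
            (1 - p)%:E * dirac (csg_full : SubG) A)%E.

End Chabauty.

HB.instance Definition _ (d : nat -> nat)
    (d_incr : {homo d : m n / (m < n)%N})
    (D : forall n, finite_SL_subgroup (d n.+1 - d n)) :=
  isTopologicalGroup.Build (Ggroup d_incr D) (@G_mul_continuous d d_incr D)
    (@G_inv_continuous d d_incr D) (@G_hausdorff d d_incr D).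

(* Main.v *)
Require Import Defs.
From HB Require Import structures.
From mathcomp Require Import all_boot all_order all_algebra.
From mathcomp Require Import all_classical all_reals all_analysis.
Set Implicit Arguments.
Unset Strict Implicit.
Unset Printing Implicit Defensive.
Import Order.TTheory GRing.Theory Num.Theory.
Local Open Scope classical_set_scope.
Local Open Scope ring_scope.

(** Let K_m be the product of the D_n with n >= m. It commutes with SL(d m, Q),
    the group G is the increasing union of the open subgroups SL(d m, Q) K_m
    ([G_decomp]), and the K_m are compact open subgroups that shrink to 1. A
    closed subgroup H of G therefore has at each level m a trace [level m H], a
    subgroup of the countable group SL(d m, Q). That a given matrix A is in it
    means that H meets a compact open coset of K_m, which is an event for the
    Chabauty topology. Hence an IRS of G induces at every level a random subgroup
    of SL(d m, Q) whose law is invariant under conjugation ([level_random]).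

    The main point is a dichotomy for such random subgroups of SL(n, Q), with
    n >= 5 odd: almost surely, they are trivial or the whole group
    ([random_SL_subgroup_dichotomy]). Given this, for almost every H all the
    traces at the infinitely many levels m where d m is odd and at least 5 are
    trivial or full. If all of them are trivial then H = 1 ([level_trivial]). If
    one of them is not, then no later one is trivial ([level_nontrivial]), so that
    H meets every coset of K_m in SL(d m, Q) K_m for infinitely many m and, being
    dense and closed, is G ([level_full]). The law of H is thus carried by the
    two points 1 and G.

    The dichotomy follows from a pigeonhole principle ([conjugates_pigeonhole]).
    Suppose that N conjugates of h are such that any two of them in H force an
    invariant property of H. Then the events that the i-th conjugate is in H
    without this property are almost disjoint and of the same probability; N
    being arbitrary, h in H almost surely forces the property. Applied to the
    transvections 1 + v f with v replaced by v + c w, it shows that one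
    transvection in H puts every other one, hence SL(n, Q), in H
    ([ae_transvection], [SL_transvection_ind]). Applied to the conjugates of h
    by the powers of a transvection t, it replaces h by its commutators with
    these powers ([commutator_forces_SL]). A first commutator turns a matrix that
    is not scalar into one with a nonzero fixed vector, a second one turns the
    latter into a transvection ([nonscalar_forces_SL],
    [fixed_vector_forces_SL]). Since n is odd, 1 is the only scalar matrix of
    determinant 1 over Q ([odd_scalar_SL]). *)

(** * Transvections *)

Section LinearAlgebra.
Variable F : fieldType.

Definition transvection n (v : 'cV[F]_n) (f : 'rV[F]_n) : 'M[F]_n :=
  1%:M + v *m f.

Definition conjm n (s A : 'M[F]_n) : 'M[F]_n := s *m A *m invmx s.

Lemma SL_unit n (A : 'M[F]_n) : \det A = 1 -> A \in unitmx.
Proof. by move=> A1; rewrite unitmxE A1 unitr1. Qed.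

Lemma invmxM n (A B : 'M[F]_n) : A \in unitmx -> B \in unitmx ->
  invmx (A *m B) = invmx B *m invmx A.
Proof.
move=> AU BU; have ABU : A *m B \in unitmx by rewrite unitmx_mul AU.
by apply: (can_inj (mulKmx ABU)); rewrite mulmxV// mulmxA mulmxK// mulmxV.
Qed.

Lemma conjm_inj n (s : 'M[F]_n) : s \in unitmx -> injective (conjm s).
Proof.
move=> sU A B /(congr1 (fun M => invmx s *m M *m s)).
by rewrite /conjm !mulmxA !mulVmx// !mul1mx !mulmxKV.
Qed.

Lemma conjmK n (s : 'M[F]_n) : s \in unitmx ->
  cancel (fun A => invmx s *m A *m s) (conjm s).
Proof. by move=> sU A; rewrite /conjm !mulmxA mulmxV// mul1mx mulmxK. Qed.

(** The columns of [cokermx U] annihilate [U], and one of them does not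
    annihilate a row that is outside the row space of [U]. *)
Lemma exists_separating_col m n (U : 'M[F]_(m, n)) (f : 'rV[F]_n) :
  ~~ (f <= U)%MS -> exists2 x : 'cV[F]_n, U *m x = 0 & f *m x = 1%:M.
Proof.
rewrite submxE => fU; have [j fj] : exists j, (f *m cokermx U) 0 j != 0.
  apply/existsP; apply: contraNT fU; rewrite negb_exists => /forallP f0.
  by apply/eqP/rowP => j; rewrite [RHS]mxE; apply/eqP; have := f0 j; rewrite negbK.
have cE p (B : 'M[F]_(p, n)) : B *m col j (cokermx U) = col j (B *m cokermx U).
  by rewrite !colE mulmxA.
exists (((f *m cokermx U) 0 j)^-1 *: col j (cokermx U)); rewrite -scalemxAr cE.
  by rewrite mulmx_coker; apply/matrixP => a b; rewrite !mxE mulr0.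
by apply/matrixP => a b; rewrite !ord1 [LHS]mxE [X in _ * X]mxE mulVf// mxE eqxx.
Qed.

Lemma exists_separating_row m n (U : 'M[F]_(n, m)) (v : 'cV[F]_n) :
  ~~ (v^T <= U^T)%MS -> exists2 f : 'rV[F]_n, f *m U = 0 & f *m v = 1%:M.
Proof.
move=> /exists_separating_col[x Ux vx]; exists x^T.
  by rewrite -[U]trmxK -trmx_mul Ux trmx0.
by rewrite -[v]trmxK -trmx_mul vx trmx1.
Qed.

Lemma line_submx_sym m (u v : 'rV[F]_m) : v != 0 -> (v <= u)%MS -> (u <= v)%MS.
Proof.
move=> v0 /sub_rVP[a vE]; apply/sub_rVP; exists a^-1.
rewrite vE scalerA mulVf ?scale1r//.
by apply: contraNneq v0 => a0; rewrite vE a0 scale0r.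
Qed.

(** The rows killed by [a] and [b] form a space of dimension at least 3, which
    does not fit in the plane spanned by [c] and [d]. *)
Lemma exists_annihilated_off_lines n (a b : 'cV[F]_n) (c d : 'rV[F]_n) : (4 < n)%N ->
  exists u : 'rV[F]_n,
    [/\ u *m a = 0, u *m b = 0, ~~ (u <= c)%MS & ~~ (u <= d)%MS].
Proof.
move=> n5; pose A := row_mx a b; pose B := col_mx c d.
have : ~~ (kermx A <= B)%MS.
  apply/negP => /mxrankS; rewrite mxrank_ker => /leq_trans/(_ (rank_leq_row B)).
  rewrite leq_subLR leqNgt => /negP; apply.
  by apply: leq_ltn_trans n5; rewrite -[4%N]/(2 + 2)%N leq_add2r rank_leq_col.
move=> /row_subPn[i]; set u := row i _ => uB; exists u.
have : u *m A = 0 by apply/sub_kermxP; exact: row_sub.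
rewrite /A mul_mx_row => uA; have := congr1 lsubmx uA; have := congr1 rsubmx uA.
rewrite row_mxKl row_mxKr => -> ->; rewrite !linear0; split=> //.
  by apply: contraNN uB => /submx_trans; apply; rewrite -addsmxE addsmxSl.
by apply: contraNN uB => /submx_trans; apply; rewrite -addsmxE addsmxSr.
Qed.

Section Transvections.
Variable n : nat.
Implicit Types (v w : 'cV[F]_n) (f g : 'rV[F]_n).

Lemma transvection0 f : transvection 0 f = 1%:M.
Proof. by rewrite /transvection mul0mx addr0. Qed.

Lemma transvectionM v f w g : f *m w = 0 ->
  transvection v f *m transvection w g = 1%:M + v *m f + w *m g.
Proof.
move=> fw; rewrite /transvection mulmxDl mul1mx mulmxDr mulmx1.
by rewrite -(mulmxA v) (mulmxA f) fw mul0mx mulmx0 addr0 addrAC.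
Qed.

Lemma transvectionD v w f : f *m w = 0 ->
  transvection v f *m transvection w f = transvection (v + w) f.
Proof. by move=> fw; rewrite transvectionM// /transvection mulmxDl addrA. Qed.

Lemma transvectionDr v f g : f *m v = 0 ->
  transvection v f *m transvection v g = transvection v (f + g).
Proof. by move=> fw; rewrite transvectionM// /transvection mulmxDr addrA. Qed.

Lemma transvectionNl v f : transvection (- v) f = transvection v (- f).
Proof. by rewrite /transvection mulNmx mulmxN. Qed.

Lemma transvectionK v f : f *m v = 0 -> transvection v f *m transvection (- v) f = 1%:M.
Proof. by move=> fv; rewrite transvectionD ?subrr ?transvection0// mulmxN fv oppr0. Qed.

Lemma transvection_unit v f : f *m v = 0 -> transvection v f \in unitmx.
Proof. by move=> /transvectionK/mulmx1_unit[]. Qed.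

Lemma transvection_inv v f : f *m v = 0 -> invmx (transvection v f) = transvection (- v) f.
Proof.
move=> fv; have U := transvection_unit fv.
by rewrite -[LHS]mulmx1 -(transvectionK fv) mulKmx.
Qed.

(** The block matrix with rows (1, -f) and (v, 1) factors both as lower times
    upper and as upper times lower triangular; this gives
    det (1 + v f) = 1 + f v. *)
Lemma transvection_det v f : f *m v = 0 -> \det (transvection v f) = 1.
Proof.
move=> fv.
have E : block_mx (1%:M : 'M[F]_1) (- f) v (1%:M : 'M[F]_n) =
   block_mx 1%:M 0 v 1%:M *m block_mx 1%:M (- f) 0 (transvection v f).
  rewrite mulmx_block !mul1mx !mul0mx !mulmx1 !addr0 /transvection.
  by rewrite mulmxN addrC addrK.
have E' : block_mx (1%:M : 'M[F]_1) (- f) v (1%:M : 'M[F]_n) =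
   block_mx 1%:M (- f) 0 1%:M *m block_mx 1%:M 0 v 1%:M.
  by rewrite mulmx_block !mul1mx !mul0mx !mulmx1 !add0r mulNmx fv oppr0 addr0.
have := congr1 determinant E; rewrite E' !det_mulmx det_lblock !det_ublock !det1.
by rewrite !mul1r => ->.
Qed.

Lemma conjm_transvection s v f : s \in unitmx ->
  conjm s (transvection v f) = transvection (s *m v) (f *m invmx s).
Proof.
by move=> sU; rewrite /conjm /transvection mulmxDr mulmx1 mulmxDl mulmxV// !mulmxA.
Qed.

Lemma outer_product_eq0 p v (f : 'rV[F]_p) : v *m f = 0 -> v != 0 -> f = 0.
Proof.
move=> vf v0; have [i vi] : exists i, v i 0 != 0.
  apply/existsP; apply: contraNT v0; rewrite negb_exists => /forallP vi0.
  by apply/eqP/colP => i; rewrite [RHS]mxE; apply/eqP; have := vi0 i; rewrite negbK.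
apply/rowP => j; have /matrixP/(_ i j) := vf; rewrite !mxE big_ord1.
by move/eqP; rewrite mulf_eq0 (negbTE vi) /= => /eqP.
Qed.

(** It is enough to test the elementary matrices with one off-diagonal entry. *)
Lemma comm_outer_products_scalar (g : 'M[F]_n) :
  (forall v f, f *m v = 0 -> g *m (v *m f) = v *m f *m g) -> is_scalar_mx g.
Proof.
case: n g => [g _|m g gC].
  by apply/is_scalar_mxP; exists 0; apply/matrixP => -[].
apply/is_scalar_mxP; exists (g 0 0).
(* Entry (k, j) of the commutation with the elementary matrix E_ij. *)
have key (i j k : 'I_m.+1) : i != j -> g k i = (k == i)%:R * g j j.
  move=> ij; have ji : j != i by rewrite eq_sym.
  have := gC (delta_mx i 0) (delta_mx 0 j).
  rewrite mul_delta_mx_0// => /(_ erefl)/matrixP/(_ k j).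
  rewrite mul_delta_mx !mxE (bigD1 i)//= !mxE !eqxx mulr1 big1 ?addr0 => [->|l li].
    rewrite (bigD1 j)//= !mxE eqxx andbT big1 ?addr0// => l lj.
    by rewrite !mxE (negbTE lj) andbF mul0r.
  by rewrite !mxE (negbTE li) mulr0.
apply/matrixP => i j; rewrite mxE.
have [->|ij] := eqVneq i j; rewrite ?mulr1n ?mulr0n; last first.
  have ji : j != i by rewrite eq_sym.
  by rewrite (key j i i ji) (negbTE ij) mul0r.
by have [->//|j0] := eqVneq j 0; rewrite (key j 0)// eqxx mul1r.
Qed.
End Transvections.

Lemma transvection_block n (x : 'cV[F]_1) (y : 'cV[F]_n) (p : 'rV[F]_1)
    (q : 'rV[F]_n) :
  transvection (col_mx x y) (row_mx p q) =
    block_mx (1%:M + x *m p) (x *m q) (y *m p) (1%:M + y *m q).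
Proof. by rewrite /transvection mul_col_row scalar_mx_block add_block_mx !add0r. Qed.

(** Transvections generate SL_n. By Gaussian elimination on the first column: a
    nonzero entry below the pivot allows one transvection to make the pivot 1,
    a second one clears the column, a third one the row, and the remaining
    block is handled by induction on the dimension. *)
Lemma SL_transvection_ind n (P : 'M[F]_n -> Prop) :
    P 1%:M -> (forall A B, P A -> P B -> P (A *m B)) ->
    (forall v f, f *m v = 0 -> P (transvection v f)) ->
  forall A, \det A = 1 -> P A.
Proof.
elim: n P => [P P1 _ _ A _|n IH].
  by rewrite (_ : A = 1%:M)//; apply/matrixP => -[].
rewrite -[n.+1]/(1 + n)%N => P P1 PM PT.
have {}IH (d : 'M[F]_n) : \det d = 1 -> P (block_mx (1%:M : 'M[F]_1) 0 0 d).
  apply: (IH (fun d => P (block_mx (1%:M : 'M[F]_1) 0 0 d))).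
  - by rewrite -scalar_mx_block.
  - move=> A B /= PA PB; have := PM _ _ PA PB.
    by rewrite mulmx_block !mul1mx !mul0mx !mulmx0 !addr0 add0r.
  - move=> v f fv; have := PT (col_mx 0 v) (row_mx 0 f).
    by rewrite mul_row_col mul0mx add0r transvection_block !mul0mx mulmx0 addr0; apply.
have step v f A : f *m v = 0 -> P (transvection v f *m A) -> P A.
  move=> fv PA; have fNv : f *m - v = 0 by rewrite mulmxN fv oppr0.
  have := PM _ _ (PT _ _ fNv) PA; rewrite mulmxA transvectionD// addNr.
  by rewrite transvection0 mul1mx.
suff PB (a : 'M[F]_1) b c (d : 'M[F]_n) :
    \det (block_mx a b c d) = 1 -> P (block_mx a b c d).
  by move=> A; rewrite -[A](@submxK _ 1 n 1 n); exact: PB.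
move: a b c d.
have piv b c (d : 'M[F]_n) :
    \det (block_mx 1%:M b c d) = 1 -> P (block_mx (1%:M : 'M[F]_1) b c d).
  move=> D; have kc : row_mx 1%:M (0 : 'rV[F]_n) *m col_mx 0 (- c) = 0.
    by rewrite mul_row_col mulmx0 mul0mx addr0.
  apply: (step _ _ _ kc).
  have E : transvection (col_mx 0 (- c)) (row_mx 1%:M 0) *m block_mx 1%:M b c d =
      block_mx 1%:M b 0 (d - c *m b).
    rewrite transvection_block !mul0mx mulmx0 !addr0 mulmx1 mulmx_block.
    by rewrite !mul0mx !mul1mx mulmx1 !addr0 addNr addrC mulNmx.
  rewrite E; have D' : \det (d - c *m b) = 1.
    have := congr1 determinant E; rewrite det_mulmx D transvection_det//.
    by rewrite mulr1 det_ublock det1 mul1r.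
  have -> : block_mx 1%:M b 0 (d - c *m b) = transvection (col_mx 1%:M 0)
      (row_mx 0 (b *m invmx (d - c *m b))) *m block_mx 1%:M 0 0 (d - c *m b).
    rewrite transvection_block !mul0mx mulmx0 !addr0 mul1mx mulmx_block.
    rewrite !mul0mx !mulmx0 !mul1mx !add0r !addr0 mulmxKV//.
    by rewrite unitmxE D' unitr1.
  apply: PM; last exact: IH.
  by apply: PT; rewrite mul_row_col mul0mx mulmx0 addr0.
have nz a b c (d : 'M[F]_n) : c != 0 ->
    \det (block_mx a b c d) = 1 -> P (block_mx (a : 'M[F]_1) b c d).
  move=> c0 D.
  have [f _ fc] : exists2 f : 'rV[F]_n, f *m (0 : 'M[F]_n) = 0 & f *m c = 1%:M.
    by apply: exists_separating_row; apply: contraNN c0; rewrite trmx0 submx0 trmx_eq0.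
  have kc : row_mx 0 ((1%:M - a) *m f) *m col_mx (1%:M : 'M[F]_1) 0 = 0.
    by rewrite mul_row_col mul0mx mulmx0 addr0.
  apply: (step _ _ _ kc); have : \det (transvection (col_mx 1%:M 0)
    (row_mx 0 ((1%:M - a) *m f)) *m block_mx a b c d) = 1.
    by rewrite det_mulmx transvection_det// mul1r.
  rewrite transvection_block !mul0mx mulmx0 !addr0 mul1mx mulmx_block.
  by rewrite !mul0mx !mul1mx -mulmxA fc mulmx1 addrC subrK; exact: piv.
move=> a b c d D; have [c0|] := eqVneq c 0; last by move/nz; apply.
(* A zero first column below the pivot: in dimension one the matrix is 1, and
   otherwise adding the first row to another one makes the column nonzero. *)
case: (pickP (@predT 'I_n)) => [i0 _|n0]; last first.
  have d1 : d = 1%:M by apply/matrixP => i; have := n0 i.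
  suff a1 : a = 1%:M by move: D; rewrite a1; exact: piv.
  move: D; rewrite c0 d1 det_ublock det1 mulr1 det_mx11 => a1.
  by apply/matrixP => i j; rewrite !ord1 a1 mxE.
pose e : 'cV[F]_n := delta_mx i0 0.
have kc : row_mx (1%:M : 'M[F]_1) (0 : 'rV[F]_n) *m col_mx 0 e = 0.
  by rewrite mul_row_col mulmx0 mul0mx addr0.
apply: (step _ _ _ kc); have : \det (transvection (col_mx 0 e)
    (row_mx (1%:M : 'M[F]_1) 0) *m block_mx a b c d) = 1.
  by rewrite det_mulmx transvection_det// mul1r.
rewrite transvection_block !mul0mx mulmx0 !addr0 mulmx1 mulmx_block.
rewrite !mul0mx !mul1mx c0 !addr0; apply: nz; apply/eqP => da.
have a0 : a = 0.
  apply/matrixP => i j; rewrite !ord1; have /matrixP/(_ i0 0) := da.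
  by rewrite !mxE big_ord1 mxE !eqxx mul1r.
by move: D; rewrite c0 a0 det_ublock det_mx11 mxE mul0r => /esym/eqP; rewrite oner_eq0.
Qed.

End LinearAlgebra.

(** * Events of a probability space *)

Section Measure.
Context {disp : measure_display} {T : measurableType disp} {R : realType}.
Variable mu : probability T R.

Lemma ae_forall_countable (I : countType) (P : I -> T -> Prop) :
  (forall i, {ae mu, forall x, P i x}) -> {ae mu, forall x, forall i, P i x}.
Proof.
move=> aeP; pose Q k x := if unpickle k is Some i then P i x else True.
have /ae_foralln : forall k, {ae mu, forall x, Q k x}.
  by move=> k; rewrite /Q; case: unpickle => [i|]; [exact: aeP|exact: aeW].
by apply: filterS => x Qx i; have := Qx (pickle i); rewrite /Q pickleK.
Qed.

Lemma measurable_forall (I : countType) (P : I -> T -> Prop) :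
  (forall i, measurable [set x | P i x]) -> measurable [set x | forall i, P i x].
Proof.
move=> mP; rewrite (_ : mkset _ = ~` \bigcup_i ~` [set x | P i x]).
  apply/measurableC/countable_bigcupT_measurable => [|i]; last exact/measurableC.
  exact: countableP.
rewrite setC_bigcup; apply/seteqP; split=> x /= Px i => [_|].
  by rewrite setCK; exact: Px.
by have := Px i Logic.I; rewrite setCK.
Qed.

Lemma measurable_imply (P : Prop) (Q : T -> Prop) :
  measurable [set x | Q x] -> measurable [set x | P -> Q x].
Proof.
move=> mQ; have [p|np] := pselect P.
  by rewrite (_ : mkset _ = [set x | Q x])//; apply/seteqP; split=> x /= => [|Qx _]; [apply|].
by rewrite (_ : mkset _ = setT)//; apply/seteqP; split=> // x _ /= /np.
Qed.

(** N almost disjoint events of the same probability p give N p <= 1. *)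
Lemma equal_measure_disjoint_null (X : set T) : measurable X ->
  (forall N : nat, exists Z : nat -> set T,
     [/\ forall i, measurable (Z i), forall i, mu (Z i) = mu X &
       forall i j, (i < j < N)%N -> mu (Z i `&` Z j) = 0%E]) ->
  mu X = 0%E.
Proof.
move=> mX HN; have Xfin : mu X \is a fin_num by exact: fin_num_measure.
suff NX N : (N%:R * fine (mu X) <= 1).
  apply/eqP; rewrite eq_le measure_ge0 andbT -(fineK Xfin) lee_fin leNgt.
  apply/negP => X0; have := NX (Num.Def.truncn (fine (mu X))^-1).+1.
  by rewrite leNgt -ltr_pdivrMr// div1r truncnS_gt.
have [Z [mZ ZX ZZ]] := HN N.
have mU n : measurable (\big[setU/set0]_(i < n) Z i) by exact: bigsetU_measurable.
suff E n : (n <= N)%N -> mu (\big[setU/set0]_(i < n) Z i) = (n%:R * fine (mu X))%:E.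
  by rewrite -lee_fin -E//; exact/probability_le1/mU.
elim: n => [|n IHn nN]; first by rewrite big_ord0 measure0 mul0r.
have UE : mu (\big[setU/set0]_(i < n) Z i `|` Z n) = (mu (\big[setU/set0]_(i < n) Z i) +
    mu (Z n) - mu (\big[setU/set0]_(i < n) Z i `&` Z n))%E.
  apply: (measureUfinl (mU n) (mZ n)).
  by rewrite -ge0_fin_numE; [exact/fin_num_measure/mU|exact: measure_ge0].
rewrite big_ord_recr/= UE.
rewrite IHn ?(ltnW nN)// ZX -{2}(fineK Xfin).
suff Z0 m : (m <= n)%N -> mu (\big[setU/set0]_(i < m) Z i `&` Z n) = 0%E.
  by rewrite Z0// sube0 -EFinD mulrSr mulrDl mul1r.
elim: m => [_|m IHm mn]; first by rewrite big_ord0 set0I measure0.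
rewrite big_ord_recr/= setIUl; apply: null_set_setU.
- exact: measurableI (mU m) (mZ n).
- exact: measurableI.
- by apply: IHm; exact: ltnW.
- by apply: ZZ; rewrite mn.
Qed.
Lemma measure_ae_eq (A B : set T) : measurable A -> measurable B ->
  {ae mu, forall x, A x <-> B x} -> mu A = mu B.
Proof.
move=> mA mB AB.
suff E (X Y : set T) : measurable X -> measurable Y -> {ae mu, forall x, X x -> Y x} ->
    mu X = mu (X `&` Y).
  rewrite (E A B) ?(E B A)// 1?setIC//; first by apply: filterS AB => x [].
  by apply: filterS AB => x [].
move=> mX mY XY; rewrite -[in LHS](setUIDK X Y) measureU0//.
- exact: measurableI.
- exact: measurableD.
apply: measure_negligible; first exact: measurableD.
by apply: negligibleS XY => x [Xx nYx] /= /(_ Xx).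
Qed.
End Measure.
(** * Random subgroups of SL_n(Q) *)

(** Invariance is expressed by lifting the conjugation by [s] to a
    measure-preserving map of the probability space, which avoids a topology on
    the space of subgroups. *)
Record random_SL_subgroup {disp : measure_display} {T : measurableType disp}
    {R : realType} (mu : probability T R) (n : nat) (H : T -> set 'M[rat]_n) : Prop := {
  rsl_measurable : forall A, measurable [set w | H w A];
  rsl_det : forall w A, H w A -> \det A = 1;
  rsl1 : forall w, H w 1%:M;
  rslM : forall w A B, H w A -> H w B -> H w (A *m B);
  rslV : forall w A, H w A -> H w (invmx A);
  rsl_conj : forall s, \det s = 1 -> exists tau : T -> T,
    (forall X, measurable X -> mu (tau @^-1` X) = mu X) /\
    (forall w A, H (tau w) (conjm s A) <-> H w A) }.

Section RandomSubgroup.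
Context {disp : measure_display} {T : measurableType disp} {R : realType}.
Variables (mu : probability T R) (n : nat) (H : T -> set 'M[rat]_n).
Hypothesis HR : random_SL_subgroup mu H.

Let H1 := rsl1 HR.
Let HM := rslM HR.
Let HV := rslV HR.
Let Hdet := rsl_det HR.
Let mH := rsl_measurable HR.

Lemma measurable_sub (C : set 'M[rat]_n) : measurable [set w | C `<=` H w].
Proof. by apply: measurable_forall => A; apply: measurable_imply; exact: mH. Qed.

(** Up to null sets, [h] being in [H] implies that [H] contains [C] exactly when
    this event is null. *)
Let bad (h : 'M[rat]_n) (C : set 'M[rat]_n) := [set w | H w h /\ ~ (C `<=` H w)].

Let measurable_bad h C : measurable (bad h C).
Proof. by apply: measurableI; [exact: mH|exact/measurableC/measurable_sub]. Qed.

Let badP h C : {ae mu, forall w, H w h -> C `<=` H w} <-> mu (bad h C) = 0%E.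
Proof.
have E : bad h C = ~` [set w | H w h -> C `<=` H w].
  by apply/seteqP; split=> w /=; rewrite not_implyE.
rewrite -[X in X <-> _]/(mu.-negligible (~` [set w | H w h -> C `<=` H w])) -E.
exact: negligibleP.
Qed.

Lemma measure_conj s h C : \det s = 1 -> (forall A, C A <-> C (conjm s A)) ->
  mu (bad (conjm s h) C) = mu (bad h C).
Proof.
move=> sdet Cs; have [tau [taumu tauH]] := rsl_conj HR sdet.
have sU := SL_unit sdet.
rewrite -taumu//; congr (mu _); apply/seteqP.
have CC w : C `<=` H (tau w) <-> C `<=` H w.
  split=> CH A; first by move=> /Cs/CH/tauH.
  by rewrite -(conjmK sU A) => /(Cs _).2/CH HA; apply/(tauH _ _).2.
by split=> w [/tauH Hh nC]; split=> // /CC.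
Qed.

(** The basic mechanism: if any two of N conjugates of [h] can lie together in
    [H] only when [H] contains [C], then the N events that one of them lies in
    [H] without [C] being contained in [H] are almost disjoint. The conjugating
    elements normalise [C], so these events have the same probability. *)
Lemma conjugates_pigeonhole h C :
    (forall N : nat, exists s : nat -> 'M[rat]_n, forall i,
      [/\ \det (s i) = 1, forall A, C A <-> C (conjm (s i) A) &
        forall j, (i < j < N)%N ->
          {ae mu, forall w, H w (conjm (s i) h) -> H w (conjm (s j) h) -> C `<=` H w}]) ->
  {ae mu, forall w, H w h -> C `<=` H w}.
Proof.
move=> HN; apply/badP; apply: equal_measure_disjoint_null => // N.
have [s sP] := HN N; exists (fun i => bad (conjm (s i) h) C); split=> //.
  by move=> i; have [sdet Cs _] := sP i; exact: measure_conj.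
move=> i j ij; have [_ _ /(_ _ ij)] := sP i.
rewrite -[X in X -> _]/(mu.-negligible (~` [set w | _])) => N0.
apply/negligibleP; first exact: measurableI.
by apply: negligibleS N0 => w [[Hi nC] [Hj _]] /= /(_ Hi Hj).
Qed.

(** Here [a] is conjugate to all the [a * U c] by elements that fix [b = U 1].
    Two of them in [H] put some [U c] with c <> 0 in [H]; parameters that are
    multiples of 1 / N! make a power of this element equal to [b]. *)
Lemma ae_one_parameter_shift (a b : 'M[rat]_n) (U s : rat -> 'M[rat]_n) :
    a \in unitmx -> (forall c, \det (s c) = 1) ->
    U 0 = 1%:M -> U 1 = b -> (forall x y, U (x + y) = U x *m U y) ->
    (forall c, conjm (s c) a = a *m U c) -> (forall c, conjm (s c) b = b) ->
  {ae mu, forall w, H w a -> H w b}.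
Proof.
move=> aU sdet U0 U1 UD sa sU.
suff : {ae mu, forall w, H w a -> [set b] `<=` H w}.
  by apply: filterS => w aC /aC; apply.
apply: conjugates_pigeonhole => N; exists (fun i => s (i%:R / (N`!)%:R)) => i.
split=> // [A|j /andP[ij jN]].
  split=> [->|]; first exact: sU.
  by move=> /= E; apply: (conjm_inj (SL_unit (sdet (i%:R / (N`!)%:R)))); rewrite sU.
apply: aeW => w; rewrite !sa => Hi Hj _ ->.
have := HM (HV Hi) Hj; set ci := i%:R / _; set cj := j%:R / _.
have UU : U ci \in unitmx.
  by apply: (mulmx1_unit (B := U (- ci)) _).1; rewrite -UD subrr.
have -> : invmx (a *m U ci) *m (a *m U cj) = U (cj - ci).
  have aUU : a *m U ci \in unitmx by rewrite unitmx_mul aU.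
  apply: (can_inj (mulKmx aUU)); rewrite mulKVmx//.
  by rewrite -mulmxA -UD addrC subrK.
move=> Hd; have Hk k : H w (U (k%:R * (cj - ci))).
  elim: k => [|k IH]; first by rewrite mul0r U0; exact: H1.
  by rewrite mulrS mulrDl mul1r UD; exact: HM.
have /dvdnP[q qE] : (j - i %| N`!)%N.
  by rewrite dvdn_fact// subn_gt0 ij /= (leq_trans (leq_subr _ _))// ltnW.
have := Hk q; rewrite (_ : q%:R * _ = 1) ?U1// /cj /ci -mulrBl -natrB 1?ltnW//.
by rewrite mulrA -natrM -qE mulfV// pnatr_eq0 -lt0n fact_gt0.
Qed.

(** For g with g w = 0 and g v = 1, the transvection 1 + c w g moves v to
    v + c w and fixes both w and f. *)
Lemma ae_transvection_col v w f :
    f *m v = 0 -> f *m w = 0 -> ~~ (v^T <= w^T)%MS ->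
  {ae mu, forall om, H om (transvection v f) -> H om (transvection w f)}.
Proof.
move=> fv fw /exists_separating_row[g gw gv].
have gcw c : (c *: g) *m w = 0 by rewrite -scalemxAl gw scaler0.
have fcw c : f *m (c *: w) = 0 by rewrite -scalemxAr fw scaler0.
have inv c : f *m invmx (transvection w (c *: g)) = f.
  by rewrite transvection_inv// mulmxDr mulmx1 mulmxA mulmxN fw oppr0 mul0mx addr0.
apply: (ae_one_parameter_shift (U := fun c => transvection (c *: w) f)
  (s := fun c => transvection w (c *: g))).
- exact: transvection_unit.
- by move=> c; exact: transvection_det.
- by rewrite scale0r transvection0.
- by rewrite scale1r.
- by move=> b c; rewrite transvectionD// scalerDl.
- move=> c; rewrite conjm_transvection ?transvection_unit// inv transvectionD//.
  by rewrite mulmxDl mul1mx -mulmxA -scalemxAl gv scalemx1 mul_mx_scalar.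
- move=> c; rewrite conjm_transvection ?transvection_unit// inv.
  by rewrite mulmxDl mul1mx -mulmxA gcw mulmx0 addr0.
Qed.

(** For x with g x = 0 and f x = 1, conjugation by 1 - c x g moves f to f + c g
    and fixes both g and v. *)
Lemma ae_transvection_row v f g :
    f *m v = 0 -> g *m v = 0 -> ~~ (f <= g)%MS ->
  {ae mu, forall om, H om (transvection v f) -> H om (transvection v g)}.
Proof.
move=> fv gv /exists_separating_col[x gx fx].
have gcx c : (- c *: g) *m x = 0 by rewrite -scalemxAl gx scaler0.
have cgv c : (c *: g) *m v = 0 by rewrite -scalemxAl gv scaler0.
have inv c : transvection x (- c *: g) *m v = v.
  by rewrite mulmxDl mul1mx -mulmxA cgv mulmx0 addr0.
apply: (ae_one_parameter_shift (U := fun c => transvection v (c *: g))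
  (s := fun c => transvection x (- c *: g))).
- exact: transvection_unit.
- by move=> c; exact: transvection_det.
- by rewrite scale0r /transvection mulmx0 addr0.
- by rewrite scale1r.
- by move=> b c; rewrite transvectionDr// scalerDl.
- move=> c; rewrite conjm_transvection ?transvection_unit// inv transvectionDr//.
  rewrite transvection_inv// transvectionNl -scaleNr opprK mulmxDr mulmx1 mulmxA.
  by rewrite fx mul1mx.
- move=> c; rewrite conjm_transvection ?transvection_unit// inv.
  rewrite transvection_inv// transvectionNl -scaleNr opprK mulmxDr mulmx1 mulmxA.
  by rewrite gx mul0mx addr0.
Qed.

Hypothesis n5 : (4 < n)%N.

(** Any two transvections are linked by changing one of the vector and the form
    at a time: (v, f), (u, f), (u, x), (u, f'), (v', f'). The vector u is killed
    by both forms and off the lines of v and v'; the form x kills u and is off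
    the lines of f and f', so that f and f' may be proportional. *)
Lemma ae_transvection (v : 'cV[rat]_n) (f : 'rV[rat]_n) (v' : 'cV[rat]_n)
    (f' : 'rV[rat]_n) : v != 0 -> f != 0 -> f *m v = 0 ->
    v' != 0 -> f' != 0 -> f' *m v' = 0 ->
  {ae mu, forall om, H om (transvection v f) -> H om (transvection v' f')}.
Proof.
move=> v0 f0 fv v'0 f'0 fv'.
have [u [uf uf' uv uv']] := exists_annihilated_off_lines f^T f'^T v^T v'^T n5.
have [fu f'u] : f *m u^T = 0 /\ f' *m u^T = 0.
  by split; apply: trmx_inj; rewrite trmx_mul trmxK trmx0.
have [x [xu _ xf xf']] := exists_annihilated_off_lines u^T 0 f f' n5.
have A1 : {ae mu, forall om, H om (transvection v f) -> H om (transvection u^T f)}.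
  apply: ae_transvection_col => //; rewrite trmxK; apply: contraNN uv.
  by apply: line_submx_sym; rewrite trmx_eq0.
have A2 : {ae mu, forall om, H om (transvection u^T f) -> H om (transvection u^T x)}.
  by apply: ae_transvection_row => //; apply: contraNN xf; exact: line_submx_sym.
have A3 : {ae mu, forall om, H om (transvection u^T x) -> H om (transvection u^T f')}.
  by apply: ae_transvection_row.
have A4 : {ae mu, forall om, H om (transvection u^T f') -> H om (transvection v' f')}.
  by apply: ae_transvection_col => //; rewrite trmxK.
by apply: filterS3 A2 A3 (filterI A1 A4) => om B2 B3 [B1 B4] /B1/B2/B3/B4.
Qed.

Definition SL_ : set 'M[rat]_n := [set A | \det A = 1].

Definition forces_SL h := {ae mu, forall om, H om h -> SL_ `<=` H om}.

Lemma transvection_forces_SL (v : 'cV[rat]_n) (f : 'rV[rat]_n) :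
  v != 0 -> f != 0 -> f *m v = 0 -> forces_SL (transvection v f).
Proof.
move=> v0 f0 fv; rewrite /forces_SL.
have : {ae mu, forall om, forall p : 'cV[rat]_n * 'rV[rat]_n, p.2 *m p.1 = 0 ->
    H om (transvection v f) -> H om (transvection p.1 p.2)}.
  apply: ae_forall_countable => -[w g] /=.
  have [gw|gw] := eqVneq (g *m w) 0; last by apply: aeW => om /eqP; rewrite (negbTE gw).
  have [->|w0] := eqVneq w 0; first by apply: aeW => om _ _; rewrite transvection0; exact: H1.
  have [->|g0] := eqVneq g 0.
    by apply: aeW => om _ _; rewrite /transvection mulmx0 addr0; exact: H1.
  have := ae_transvection v0 f0 fv w0 g0 gw.
  by apply: filterS => om + _; exact.
apply: filterS => om Hall Hvf A; apply: SL_transvection_ind.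
- exact: H1.
- exact: HM.
- by move=> w g gw; exact: (Hall (w, g)).
Qed.

Lemma SLset_conj s A : \det s = 1 -> SL_ A <-> SL_ (conjm s A).
Proof.
move=> s1; rewrite /SL_ /= /conjm !det_mulmx det_inv s1 invr1.
by rewrite mul1r mulr1.
Qed.

Lemma conj_forces_SL s h : \det s = 1 -> forces_SL h -> forces_SL (conjm s h).
Proof.
move=> s1 /badP h0; apply/badP; rewrite measure_conj// => A; exact: SLset_conj.
Qed.

(** For the one-parameter group t_i = 1 + i v f, two conjugates of [h] by t_i and
    t_j in [H] put a conjugate of the commutator of the inverse of [h] with
    t_(j - i) in [H]. *)
Lemma commutator_forces_SL v f h : f *m v = 0 -> \det h = 1 ->
    (forall c, c != 0 -> forces_SL (invmx h *m transvection v (c *: f) *m h *m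
        transvection v (- c *: f))) ->
  forces_SL h.
Proof.
move=> fv h1 hc; have hU := SL_unit h1.
have cfv c : (c *: f) *m v = 0 by rewrite -scalemxAl fv scaler0.
apply: conjugates_pigeonhole => N; exists (fun i => transvection v (i%:R *: f)) => i.
split=> [|A|j /andP[ij _]]; first exact: transvection_det.
  by apply: SLset_conj; exact: transvection_det.
set c : rat := (j - i)%:R.
have c0 : c != 0 by rewrite pnatr_eq0 subn_eq0 -ltnNge.
have si1 : \det (transvection v (i%:R *: f)) = 1 by exact: transvection_det.
apply: filterS (conj_forces_SL si1 (hc c c0)) => om Hf Hi Hj; apply: Hf.
have := HM (HV Hi) Hj; congr (H om _).
have siU := SL_unit si1.
have E1 : invmx (transvection v (i%:R *: f)) *m transvection v (j%:R *: f) =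
    transvection v (c *: f).
  rewrite transvection_inv// transvectionNl -scaleNr transvectionDr// -scalerDl.
  by rewrite /c natrB ?(ltnW ij)// addrC.
have E2 : transvection v (- c *: f) *m invmx (transvection v (i%:R *: f)) =
    invmx (transvection v (j%:R *: f)).
  rewrite !transvection_inv// !transvectionNl -!scaleNr transvectionDr// -scalerDl.
  by rewrite /c natrB ?(ltnW ij)// opprB addrAC subrr add0r.
rewrite /conjm -E1 !invmxM ?unitmx_mul ?unitmx_inv ?siU ?hU// invmxK -E2.
by rewrite !mulmxA.
Qed.

(** When [h] fixes v, its commutators with the transvections 1 + c v f are the
    transvections 1 + c v (f h - f). All of them are trivial only if [h - 1] has
    its image in the line of v, and then [h] itself is a transvection. *)
Lemma fixed_vector_forces_SL (v : 'cV[rat]_n) (h : 'M[rat]_n) :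
  v != 0 -> h *m v = v -> \det h = 1 -> h != 1%:M -> forces_SL h.
Proof.
move=> v0 hv h1 hn1; have hU := SL_unit h1.
have hVv : invmx h *m v = v by rewrite -{1}hv mulKmx.
have [[f [fv fh]]|none] := pselect (exists f : 'rV[rat]_n, f *m v = 0 /\ f *m h != f).
  have fhv : f *m h *m v = 0 by rewrite -mulmxA hv.
  apply: (commutator_forces_SL fv h1) => c c0.
  have -> : invmx h *m transvection v (c *: f) *m h = transvection v (c *: (f *m h)).
    rewrite /transvection mulmxDr mulmx1 mulmxDl mulVmx// mulmxA hVv.
    by rewrite -!mulmxA -scalemxAl.
  rewrite transvectionDr ?scaleNr -?scalerBr; last by rewrite -scalemxAl fhv scaler0.
  apply: transvection_forces_SL => //; first by rewrite scaler_eq0 negb_or c0 subr_eq0.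
  by rewrite -scalemxAl mulmxBl fhv fv subrr scaler0.
have : ((h - 1%:M)^T <= v^T)%MS.
  apply/row_subP => i; rewrite -tr_col.
  apply: contrapT => /negP/exists_separating_row[f fv].
  rewrite colE mulmxA mulmxBr mulmx1.
  have [->|fh] := eqVneq (f *m h) f; last by case: none; exists f.
  by rewrite subrr mul0mx => /matrixP/(_ 0 0)/eqP; rewrite !mxE eqxx eq_sym oner_eq0.
move=> /submxP[D /(congr1 trmx)]; rewrite trmx_mul !trmxK => hD.
have hE : h = transvection v D^T by rewrite /transvection -hD addrC subrK.
have Dv : D^T *m v = 0.
  by apply: (outer_product_eq0 (v := v)) => //; rewrite mulmxA -hD mulmxBl hv mul1mx subrr.
rewrite hE; apply: transvection_forces_SL => //.
by apply: contraNneq hn1 => D0; rewrite hE D0 /transvection mulmx0 addr0.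
Qed.

(** A transvection t that does not commute with [h] gives a nontrivial commutator,
    which is a product of two transvections and so fixes the vectors that both
    of their forms kill. *)
Lemma nonscalar_forces_SL (h : 'M[rat]_n) : \det h = 1 -> ~~ is_scalar_mx h -> forces_SL h.
Proof.
move=> h1 hs; have hU := SL_unit h1.
have [[v [f [fv hvf]]]|none] := pselect (exists (v : 'cV[rat]_n) (f : 'rV[rat]_n),
    f *m v = 0 /\ h *m (v *m f) <> v *m f *m h); last first.
  case/negP: hs; apply: comm_outer_products_scalar => v f fv; apply: contrapT => hvf.
  by apply: none; exists v, f.
apply: (commutator_forces_SL fv h1) => c c0; set t := transvection v (c *: f).
have cfv : (c *: f) *m v = 0 by rewrite -scalemxAl fv scaler0.
have tN : transvection v (- c *: f) = invmx t.
  by rewrite transvection_inv// transvectionNl scaleNr.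
have t1 : \det t = 1 by exact: transvection_det.
have tU := SL_unit t1.
have [u [uf uhf u0 _]] := exists_annihilated_off_lines f^T (f *m h)^T 0 0 n5.
have fu : f *m u^T = 0 by apply: trmx_inj; rewrite trmx_mul trmxK trmx0.
have fhu : f *m h *m u^T = 0 by apply: trmx_inj; rewrite trmx_mul trmxK trmx0.
have tu (p : nat) (w : 'M[rat]_(n, p)) : f *m w = 0 -> t *m w = w.
  by move=> fw; rewrite mulmxDl mul1mx -mulmxA -scalemxAl fw scaler0 mulmx0 addr0.
rewrite tN; apply: (@fixed_vector_forces_SL u^T).
- by rewrite trmx_eq0; apply: contraNneq u0 => ->; rewrite sub0mx.
- have tVu : invmx t *m u^T = u^T by rewrite -{1}(tu _ _ fu) mulKmx.
  have thu : t *m (h *m u^T) = h *m u^T by apply: tu; rewrite mulmxA.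
  by rewrite -!mulmxA tVu thu mulKmx.
- by rewrite !det_mulmx !det_inv h1 t1 invr1 !mulr1.
- apply/eqP => E; apply: hvf.
  have : t *m h = h *m t.
    have := congr1 (fun M => h *m M *m t) E.
    by rewrite !mulmxA mulmxV// mul1mx mulmxKV// mulmx1.
  rewrite mulmxDl mulmxDr mul1mx mulmx1 => /addrI; rewrite -scalemxAr -scalemxAl -scalemxAr.
  by move/(scalerI c0).
Qed.

Lemma odd_scalar_SL (h : 'M[rat]_n) : odd n -> \det h = 1 -> is_scalar_mx h -> h = 1%:M.
Proof.
move=> nodd h1 /is_scalar_mxP[a hE]; rewrite hE; congr _%:M.
move: h1; rewrite hE det_scalar => an.
have n0 : (0 < n)%N by case: (n) nodd.
have a0 : 0 <= a.
  rewrite leNgt; apply/negP => a0; have := exprn_odd_lt0 a nodd.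
  by rewrite a0 an ltr10.
by apply/eqP; rewrite -(pexpr_eq1 n0 a0) an.
Qed.

Theorem random_SL_subgroup_dichotomy : odd n ->
  {ae mu, forall om, (forall A, H om A -> A = 1%:M) \/
    (forall A, \det A = 1 -> H om A)}.
Proof.
move=> nodd.
have : {ae mu, forall om, forall A, A != 1%:M -> H om A -> SL_ `<=` H om}.
  apply: ae_forall_countable => A.
  have [->|A1] := eqVneq A 1%:M; first by apply: aeW => om /negP[].
  have [detA|detA] := eqVneq (\det A) 1; last first.
    by apply: aeW => om _ /Hdet/eqP; rewrite (negbTE detA).
  have /nonscalar_forces_SL : ~~ is_scalar_mx A.
    by apply: contraNN A1 => sA; apply/eqP; exact: odd_scalar_SL.
  by move=> /(_ detA); apply: filterS => om + _; exact.
apply: filterS => om HA.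
have [[A A1 HAA]|none] := pselect (exists2 A, A != 1%:M & H om A).
  by right; exact: HA A1 HAA.
left=> A HAA; apply/eqP/negPn/negP => A1; apply: none; by exists A.
Qed.

End RandomSubgroup.

(** * Block operators *)

Lemma block_op1 m k : block_op m (1%:M : 'M[rat]_k) =1 e_.
Proof.
move=> i; have [/andP[mi ik]|?] := boolP (m <= i < m + k)%N; last exact: block_op_out.
have lt : (i - m < k)%N by rewrite ltn_subLR.
rewrite -(subnKC mi) (block_op_in _ _ (Ordinal lt)) (bigD1 (Ordinal lt))//= mxE eqxx.
by rewrite scale1r big1 ?addr0// => l lj; rewrite mxE (negbTE lj) scale0r.
Qed.

Lemma block_opM n (A B : 'M[rat]_n) i :
  linext (block_op 0 A) (block_op 0 B i) = block_op 0 (A *m B) i.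
Proof.
have [im|ni] := ltnP i n; last first.
  by rewrite !block_op_out -?leqNgt//= linext_e block_op_out -?leqNgt.
rewrite -[i]/(0 + Ordinal im)%N !block_op_in linear_sum /=.
under eq_bigr do
  rewrite linearZ /= linext_e -[X in block_op _ _ X]add0n block_op_in scaler_sumr.
rewrite exchange_big /=; apply: eq_bigr => l _; rewrite mxE scaler_suml.
by apply: eq_bigr => h _; rewrite scalerA mulrC.
Qed.

Lemma block_op_inj n : injective (fun A : 'M[rat]_n => block_op 0 A).
Proof.
move=> A B AB; apply/matrixP => i j; have := congr1 (fun f => f (0 + j)%N) AB.
rewrite /= !block_op_in => /(congr1 (fun p : {poly rat} => p`_(0 + i))).
by rewrite !coef_block.
Qed.

Lemma block_op_extend n k (A : 'M[rat]_n) :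
  block_op 0 (block_mx A 0 0 (1%:M : 'M[rat]_k)) =1 block_op 0 A.
Proof.
move=> i; have [im|ni] := ltnP i n; last first.
  rewrite [RHS]block_op_out -?leqNgt//.
  have [ink|?] := ltnP i (n + k)%N; last by rewrite block_op_out -?leqNgt.
  have lt : (i - n < k)%N by rewrite ltn_subLR.
  have -> : i = (0 + rshift n (Ordinal lt))%N by rewrite /= subnKC.
  rewrite block_op_in big_split_ord/= big1 ?add0r => [|l _]; last first.
    by rewrite block_mxEur mxE scale0r.
  rewrite (bigD1 (Ordinal lt))//= block_mxEdr mxE eqxx scale1r big1 ?addr0// => l lj.
  by rewrite block_mxEdr mxE (negbTE lj) scale0r.
have -> : i = (0 + lshift k (Ordinal im))%N by [].
rewrite block_op_in big_split_ord/= [X in _ + X]big1 ?addr0 => [|l _]; last first.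
  by rewrite block_mxEdl mxE scale0r.
rewrite -[X in block_op _ _ X]/(0 + Ordinal im)%N block_op_in.
by apply: eq_bigr => l _; rewrite block_mxEul.
Qed.

Lemma block_op_shift n k (A : 'M[rat]_k) :
  block_op 0 (block_mx (1%:M : 'M[rat]_n) 0 0 A) =1 block_op n A.
Proof.
move=> i; have [im|ni] := ltnP i n.
  rewrite [RHS]block_op_out; last by rewrite leqNgt im.
  have -> : i = (0 + lshift k (Ordinal im))%N by [].
  rewrite block_op_in big_split_ord/= [X in _ + X]big1 ?addr0 => [|l _]; last first.
    by rewrite block_mxEdl mxE scale0r.
  rewrite (bigD1 (Ordinal im))//= block_mxEul mxE eqxx scale1r big1 ?addr0// => l lj.
  by rewrite block_mxEul mxE (negbTE lj) scale0r.
have [ink|?] := ltnP i (n + k)%N; last first.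
  by rewrite !block_op_out -?leqNgt// ni -leqNgt.
have lt : (i - n < k)%N by rewrite ltn_subLR.
have -> : i = (0 + rshift n (Ordinal lt))%N by rewrite /= subnKC.
rewrite block_op_in big_split_ord/= big1 ?add0r => [|l _]; last first.
  by rewrite block_mxEur mxE scale0r.
rewrite -[X in block_op _ _ X]/(n + Ordinal lt)%N block_op_in.
by apply: eq_bigr => l _; rewrite block_mxEdr.
Qed.

Lemma gl_eq (f g : GLinf) : (forall i, f (e_ i) = g (e_ i)) -> f = g.
Proof.
move=> fg; apply/glP/linear_eq_basis => //; first by case: (glfunP f).
by case: (glfunP g).
Qed.

Lemma gl_fix_support (f : GLinf) (v : {poly rat}) :
  (forall i, v`_i != 0 -> f (e_ i) = e_ i) -> f v = v.
Proof.
move=> fv; have [Lf _] := glfunP f.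
pose f' : {linear {poly rat} -> {poly rat}} := HB.pack (glfun f)
  (GRing.isLinear.Build rat {poly rat} {poly rat} _ (glfun f) Lf).
rewrite -[glfun f]/(f' : _ -> _) -{1}[v]coefK poly_def linear_sum -[RHS]coefK poly_def.
apply: eq_bigr => i _; rewrite linearZ /=.
by have [->|vi] := eqVneq v`_i 0; rewrite ?scale0r// fv.
Qed.

(** * The levels SL(d m, Q) K_m *)

Section LevelStructure.
Variables (d : nat -> nat) (d_incr : {homo d : m n / (m < n)%N}).
Variable D : forall n, finite_SL_subgroup (d n.+1 - d n).
Local Notation G := (Ggroup d_incr D).
Local Notation iota := (@iota_prod d d_incr D).
Local Notation K m := (cyl (1%g : block_prod D) m).

(** The elements of SL(d m, Q) in [G] are handled through this relation instead of
    an embedding, which would need a proof that the determinant is 1. *)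
Definition acts m (A : 'M[rat]_(d m)) (g : G) := forall i, val g (e_ i) = block_op 0 A i.
Arguments acts : clear implicits.

Lemma acts_linext m A g : acts m A g -> val g =1 linext (block_op 0 A).
Proof.
move=> gA; apply: linear_eq_basis; [by case: (glfunP (val g))|exact: linext_is_linear|].
by move=> i; rewrite linext_e.
Qed.

Lemma acts_inj m A g h : acts m A g -> acts m A h -> g = h.
Proof. by move=> gA hA; apply/val_inj/gl_eq => i; rewrite gA hA. Qed.

Lemma acts_uniq m A B g : acts m A g -> acts m B g -> A = B.
Proof. by move=> gA gB; apply: block_op_inj; apply/funext => i; rewrite -gA -gB. Qed.

Lemma acts1 m : acts m 1%:M 1%g.
Proof. by move=> i; rewrite block_op1. Qed.

Lemma actsM m A B g h : acts m A g -> acts m B h -> acts m (A *m B) (g * h)%g.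
Proof.
by move=> gA hB i; rewrite -block_opM -(acts_linext gA) -hB.
Qed.

Lemma acts_exists m A : \det A = 1 -> exists g, acts m A g.
Proof.
move=> A1; have AU := SL_unit A1.
have K (B C : 'M[rat]_(d m)) : B *m C = 1%:M ->
    cancel (linext (block_op 0 C)) (linext (block_op 0 B)).
  move=> BC; apply: (linear_eq_basis (g := id)) => //.
    by move=> a u v /=; rewrite !linearP.
  by move=> i /=; rewrite linext_e block_opM BC block_op1.
have bijA : linear (linext (block_op 0 A)) /\ bijective (linext (block_op 0 A)).
  split; first exact: linext_is_linear.
  exists (linext (block_op 0 (invmx A))); apply: K; first exact: mulVmx.
  exact: mulmxV.
have SLg : SLinf (GLInf bijA) by exists (d m), A; split=> // i /=; rewrite linext_e.
have Gg : Gset d_incr D (GLInf bijA) by apply: sub_generated; left.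
by exists (SigSub (mem_set Gg)) => i /=; rewrite linext_e.
Qed.

Lemma actsV m A g : \det A = 1 -> acts m A g -> acts m (invmx A) g^-1%g.
Proof.
move=> A1 gA; have AU := SL_unit A1.
have [h hA] : exists h, acts m (invmx A) h by apply: acts_exists; rewrite det_inv A1 invr1.
suff -> : g^-1%g = h by [].
apply: (mulgI g); rewrite mulgV; apply: (@acts_inj m 1%:M); first exact: acts1.
by have := actsM gA hA; rewrite mulmxV.
Qed.

Lemma acts_conj m S A s g : \det S = 1 -> acts m S s -> acts m A g ->
  acts m (conjm S A) (s * g * s^-1)%g.
Proof. by move=> S1 sS gA; apply: actsM; [exact: actsM|exact: actsV]. Qed.

Lemma acts_widen m m' A g : (m <= m')%N -> \det A = 1 -> acts m A g ->
  exists2 B, \det B = 1 & acts m' B g.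
Proof.
move=> mm' A1 gA; rewrite /acts -(subnKC (d_le d_incr mm')).
exists (block_mx A 0 0 1%:M); first by rewrite det_ublock A1 det1 mul1r.
by move=> i; rewrite block_op_extend.
Qed.

Lemma iota_fixes_low m q i : K m q -> (i < d m)%N -> val (iota q) (e_ i) = e_ i.
Proof.
move=> q1 im /=; rewrite linext_e; case: (blockdiag_cases d_incr i) => [[n [j iE]]|[_ ->//]].
rewrite iE (blockdiag_in d_incr) q1.
  by rewrite -(blockdiag_in d_incr (bp_mx (1%g : block_prod D)))
    -(linext_e (blockdiag_op _)) (blockdiag1 d_incr).
rewrite ltnNge; apply/negP => /(d_le d_incr) mn.
by move: im; rewrite iE ltnNge (leq_trans mn)// leq_addr.
Qed.

Lemma iota_preserves_high m q i j : K m q -> (d m <= i)%N ->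
  (val (iota q) (e_ i))`_j != 0 -> (d m <= j)%N.
Proof.
move=> q1 mi /=; rewrite linext_e.
case: (blockdiag_cases d_incr i) => [[n [l iE]]|[_ ->]]; last first.
  by rewrite coefXn; have [->//|_] := eqVneq j i; rewrite eqxx.
have mn : (m <= n)%N.
  rewrite -ltnS ltnNge; apply/negP => /(d_le d_incr) nm.
  by have := leq_trans nm mi; rewrite leqNgt iE -ltn_subRL ltn_ord.
rewrite iE (blockdiag_in d_incr) coef_sum; apply: contraNT; rewrite -ltnNge => jm.
rewrite big1// => k _; rewrite coefZ coefXn ltn_eqF ?mulr0//.
by rewrite (leq_trans jm)// (leq_trans (d_le d_incr mn))// leq_addr.
Qed.

(** The two elements move basis vectors of disjoint sets of indices. *)
Lemma acts_commute m A g q : acts m A g -> K m q -> (g * iota q = iota q * g)%g.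
Proof.
move=> gA q1; apply/val_inj/gl_eq => i.
change (val g (val (iota q) (e_ i)) = val (iota q) (val g (e_ i))).
have [im|mi] := ltnP i (d m).
  rewrite (iota_fixes_low q1 im) (gl_fix_support (f := val (iota q)))// => j; rewrite gA => Aj.
  apply: (iota_fixes_low q1); apply: contraNT Aj; rewrite -leqNgt => mj.
  rewrite -[i]/(0 + Ordinal im)%N block_op_in coef_sum big1// => l _.
  by rewrite coefZ coefXn gtn_eqF ?mulr0// (leq_trans (ltn_ord l)).
have ghigh j : (d m <= j)%N -> val g (e_ j) = e_ j.
  by move=> mj; rewrite gA block_op_out// -leqNgt.
rewrite (ghigh _ mi) gl_fix_support// => j /(iota_preserves_high q1 mi); exact: ghigh.
Qed.

Lemma acts_iota m A q : acts m A (iota q) -> K m q -> A = 1%:M.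
Proof.
move=> qA q1; apply: (acts_uniq qA) => i; rewrite block_op1.
have [im|mi] := ltnP i (d m); first exact: (iota_fixes_low q1).
by rewrite qA block_op_out// -leqNgt.
Qed.

(** The blocks of index less than m all lie in SL(d m, Q): the block of index m is
    split off at each step of the induction and absorbed at the next level. *)
Lemma iota_decomp x m : exists A s q,
  [/\ \det A = 1, acts m A s, K m q & iota x = (s * iota q)%g].
Proof.
elim: m => [|m [A [s [q [A1 sA q1 xE]]]]].
  exists 1%:M, 1%g, x; split=> //; first exact: det1.
    exact: acts1.
  by rewrite mul1g.
pose head n : 'M[rat]_(d n.+1 - d n) := if n == m then bp_mx q n else 1%:M.
pose tail n : 'M[rat]_(d n.+1 - d n) := if n == m then 1%:M else bp_mx q n.
have headP n : fsl_set (D n) (head n).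
  by rewrite /head; case: eqP => _; [exact: bp_mxP|exact: fsl1].
have tailP n : fsl_set (D n) (tail n).
  by rewrite /tail; case: eqP => _; [exact: fsl1|exact: bp_mxP].
pose y : block_prod D := bp_mk headP; pose z : block_prod D := bp_mk tailP.
have qE : q = (y * z)%g.
  apply: bp_eq; apply/functional_extensionality_dep => n.
  by rewrite bp_mxM !bp_mkK /head /tail; case: eqP => _; rewrite ?mulmx1 ?mul1mx.
have [B B1 yB] : exists2 B : 'M[rat]_(d m.+1), \det B = 1 & acts m.+1 B (iota y).
  have dm : (d m <= d m.+1)%N by exact/ltnW/d_incr.
  suff : exists2 B : 'M[rat]_(d m + (d m.+1 - d m)), \det B = 1 &
      forall i, val (iota y) (e_ i) = block_op 0 B i by rewrite subnKC.
  exists (block_mx (1%:M : 'M[rat]_(d m)) 0 0 (bp_mx q m)).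
    by rewrite det_ublock det1 mul1r (fsl_det (bp_mxP q m)).
  move=> i; rewrite block_op_shift /= linext_e.
  case: (blockdiag_cases d_incr i) => [[n [j ->]]|[i0 ->]]; last first.
    by rewrite block_op_out// negb_and -ltnNge (leq_trans i0)// (d_le d_incr).
  rewrite (blockdiag_in d_incr) bp_mkK /head; have [nm|nm] := eqVneq n m.
    by move: j; rewrite nm => j; rewrite block_op_in.
  rewrite (bigD1 j)//= mxE eqxx scale1r big1 ?addr0 => [|l lj]; last first.
    by rewrite mxE (negbTE lj) scale0r.
  rewrite block_op_out//; apply: contraNN nm => /andP[mj jm].
  apply/eqP; apply: (block_uniq d_incr (i := (d n + j)%N)).
    by rewrite leq_addr -ltn_subRL /=.
  by rewrite mj /= (leq_trans jm)// subnKC.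
have [A' A'1 sA'] := acts_widen (leqnSn m) A1 sA.
exists (A' *m B), (s * iota y)%g, z; split.
- by rewrite det_mulmx A'1 B1 mulr1.
- exact: actsM.
- move=> n; rewrite ltnS leq_eqVlt bp_mkK /tail; have [->|nm] //= := eqVneq n m.
  by move=> /q1.
- by rewrite xE qE iota_prodM mulgA.
Qed.

(** Every generator is eventually in the group SL(d m, Q) K_m, and these groups
    increase with m. *)
Lemma G_decomp (g : G) : exists m0, forall m, (m0 <= m)%N -> exists A s q,
  [/\ \det A = 1, acts m A s, K m q & g = (s * iota q)%g].
Proof.
pose dec (h : G) := exists m0, forall m, (m0 <= m)%N -> exists A s q,
  [/\ \det A = 1, acts m A s, K m q & h = (s * iota q)%g].
pose M : set GLinf := [set x | exists2 h : G, val h = x & dec h].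
have MG : group_closed (mem M).
  split; first rewrite in_setE.
    exists 1%g => //; exists 0%N => m _; exists 1%:M, 1%g, 1%g; split=> //.
    - exact: det1.
    - exact: acts1.
    - by rewrite mul1g iota_prod1.
  move=> x1 x2; rewrite !in_setE => -[h1 <- [m1 D1]] [h2 <- [m2 D2]].
  exists (h1 * h2^-1)%g => //; exists (maxn m1 m2) => m; rewrite geq_max => /andP[m1m m2m].
  have [A1 [s1 [q1 [dA1 sA1 K1 ->]]]] := D1 m m1m.
  have [A2 [s2 [q2 [dA2 sA2 K2 ->]]]] := D2 m m2m.
  exists (A1 *m invmx A2), (s1 * s2^-1)%g, (q1 * q2^-1)%g; split.
  - by rewrite det_mulmx det_inv dA1 dA2 invr1 mulr1.
  - by apply: actsM => //; exact: actsV.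
  - by apply: cyl1M => //; exact: cyl1V.
  - have s2V := acts_commute (actsV dA2 sA2) (cyl1M K1 (cyl1V K2)).
    by rewrite -[RHS]mulgA s2V iota_prodM iota_prodV invgM !mulgA.
have AM : SLinf `|` range (blockdiag d_incr (D := D)) `<=` M.
  move=> x Ax; have Gx : Gset d_incr D x by exact: sub_generated.
  exists (SigSub (mem_set Gx)) => //.
  case: Ax => [[n [A [A1 xA]]]|[y _ yx]].
    exists n => m nm; have nd : (n <= d m)%N by rewrite (leq_trans nm)// (d_ge d_incr).
    suff [B B1 xB] : exists2 B : 'M[rat]_(d m), \det B = 1 &
        forall i, x (e_ i) = block_op 0 B i.
      exists B, (SigSub (mem_set Gx)), 1%g; split=> //.
      by rewrite iota_prod1 mulg1.
    rewrite -(subnKC nd); exists (block_mx A 0 0 1%:M).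
      by rewrite det_ublock A1 det1 mul1r.
    by move=> i; rewrite block_op_extend.
  exists 0%N => m _; rewrite (_ : SigSub _ = iota y); first exact: iota_decomp.
  by apply: val_inj => /=.
have [k /val_inj-> //] : M (val g) by apply: (set_valP g); split.
Qed.

(** * The trace of a closed subgroup at a level *)

(** The image of the intersection of [H] with SL(d m, Q) K_m under the projection
    to SL(d m, Q): the matrices whose coset of K_m meets [H]. *)
Definition level (m : nat) (H : set G) : set 'M[rat]_(d m) :=
  [set A | \det A = 1 /\ exists g q, [/\ acts m A g, K m q & H (g * iota q)%g]].
Arguments level : clear implicits.

Lemma compact_block_prod : compact [set: block_prod D].
Proof.
have -> : [set: block_prod D] =
    [set f | forall n, [set: discrete_topology (set_type (D n))] (f n)].
  by apply/seteqP; split.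
apply: (@tychonoff nat (fun n => discrete_topology (set_type (D n))) (fun=> setT)) => n.
apply: finite_compact.
rewrite (_ : setT = (val : set_type (D n) -> _) @^-1` (D n : set _)).
  by apply: finite_preimage; [move=> x y _ _; exact: val_inj|exact: fsl_finite].
by apply/seteqP; split=> // x _; exact: set_valP.
Qed.

Let open_translate (g : G) m : open [set (g * iota q)%g | q in K m].
Proof.
have oK : open (K m).
  by apply/open_bpP => x x1; exists m => y yx n nm; rewrite yx// x1.
have := G_mulL g^-1%g (iota_prod_open (d_incr := d_incr) oK).
congr open; apply/funext => x /=; apply/propext; split=> -[q q1 E]; exists q => //.
  by rewrite E mulVKg.
by rewrite -E mulKg.
Qed.

Let precompact_translate (g : G) m : precompact [set (g * iota q)%g | q in K m].
Proof.
apply: (@precompact_subset _ _ [set (g * iota q)%g | q in setT]).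
  by move=> x [q _ <-]; exists q.
apply: compact_precompact; first exact: G_hausdorff.
have -> : [set (g * iota q)%g | q in setT] = (fun x : G => (g * x)%g) @` (iota @` setT).
  by rewrite image_comp.
apply: continuous_compact.
  apply: continuous_subspaceT; apply/continuousP => U oU; exact: G_mulL.
apply: continuous_compact; last exact: compact_block_prod.
by apply: continuous_subspaceT; exact: iota_prod_continuous.
Qed.

Lemma measurable_meets (V : set G) : open V -> precompact V ->
  measurable ([set H | (H : closed_subgroup G) `&` V !=set0] : set (SubG G)).
Proof.
move=> oV cV; apply: sub_sigma_algebra.
set X := mkset _; exists [set X]; last by rewrite bigcup_set1.
move=> _ ->; apply: (@finI_from1 _ _ _ id X).
by left; exists V.
Qed.

(** The cosets of K_m are open and relatively compact, and such sets are those
    that define the topology of the space of closed subgroups. *)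
Lemma measurable_level m A :
  measurable ([set H | level m (H : closed_subgroup G) A] : set (SubG G)).
Proof.
have [A1|nA] := eqVneq (\det A) 1; last first.
  rewrite (_ : mkset _ = set0)//; apply/seteqP; split=> // H [/eqP].
  by rewrite (negbTE nA).
have [g gA] := acts_exists A1.
rewrite (_ : mkset _ = [set H | (H : closed_subgroup G) `&`
    [set (g * iota q)%g | q in K m] !=set0]).
  by apply: measurable_meets; [exact: open_translate|exact: precompact_translate].
apply/seteqP; split=> H /=.
  move=> [_ [s [q [sA q1 Hsq]]]]; exists (s * iota q)%g; split=> //.
  by exists q => //; rewrite (acts_inj sA gA).
by move=> [x [Hx [q q1 xE]]]; split=> //; exists g, q; split=> //; rewrite xE.
Qed.

Section ClosedSubgroup.
Variable H : closed_subgroup G.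

Lemma csg1 : (H : set G) 1%g.
Proof. by have [+ _] := csg_group H; rewrite in_setE. Qed.

Lemma csgV x : (H : set G) x -> (H : set G) x^-1%g.
Proof.
have [_ HV] := csg_group H => Hx.
by have := HV 1%g x; rewrite !in_setE mul1g; apply; [exact: csg1|].
Qed.

Lemma csgM x y : (H : set G) x -> (H : set G) y -> (H : set G) (x * y)%g.
Proof.
have [_ HV] := csg_group H => Hx /csgV Hy.
by have := HV x y^-1%g; rewrite !in_setE invgK; apply.
Qed.

Lemma level1 m : level m H 1%:M.
Proof.
split; first exact: det1.
exists 1%g, 1%g; split=> //; first exact: acts1.
by rewrite iota_prod1 mulg1; exact: csg1.
Qed.

Lemma levelM m A B : level m H A -> level m H B -> level m H (A *m B).
Proof.
move=> [A1 [g [q [gA q1 Hg]]]] [B1 [h [r [hB r1 Hh]]]].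
split; first by rewrite det_mulmx A1 B1 mulr1.
exists (g * h)%g, (q * r)%g; split; [exact: actsM|exact: cyl1M|].
have := csgM Hg Hh; congr ((H : set G) _).
by rewrite -mulgA [(iota q * _)%g]mulgA -(acts_commute hB q1) iota_prodM !mulgA.
Qed.

Lemma levelV m A : level m H A -> level m H (invmx A).
Proof.
move=> [A1 [g [q [gA q1 Hg]]]]; split; first by rewrite det_inv A1 invr1.
exists g^-1%g, q^-1%g; split; [exact: actsV|exact: cyl1V|].
have := csgV Hg; congr ((H : set G) _).
by rewrite (acts_commute gA q1) invgM iota_prodV.
Qed.
End ClosedSubgroup.

Lemma level_conj m S s A (H : closed_subgroup G) : \det S = 1 -> acts m S s ->
  level m H A -> level m (csg_conj s H) (conjm S A).
Proof.
move=> S1 sS [A1 [g [q [gA q1 Hg]]]]; split.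
  by rewrite /conjm !det_mulmx det_inv S1 A1 invr1 !mulr1.
exists (s * g * s^-1)%g, q; split=> //; first exact: acts_conj.
exists (g * iota q)%g => //.
by rewrite -[RHS]mulgA (acts_commute (actsV S1 sS) q1) !mulgA.
Qed.

Lemma csg_conjK (s : G) : cancel (csg_conj s) (csg_conj s^-1%g).
Proof.
move=> H; apply: csgP; apply/seteqP; split=> x /=.
  by move=> [_ [h Hh <-] <-]; rewrite invgK !mulgA mulVg mul1g mulgVK.
move=> Hx; exists (s * x * s^-1)%g; first by exists x.
by rewrite invgK !mulgA mulVg mul1g mulgVK.
Qed.

Lemma level_random (R : realType) (mu : probability (SubG G) R) m : is_IRS mu ->
  random_SL_subgroup mu (fun H : SubG G => level m (H : closed_subgroup G)).
Proof.
move=> irs; split=> [A|H A [] //|H|H A B|H A|S S1].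
- exact: measurable_level.
- exact: level1.
- exact: levelM.
- exact: levelV.
have [s sS] := acts_exists S1; exists (csg_conj s); split=> [X mX|H A]; first exact: irs.
split=> [|HA]; last exact: level_conj.
move=> /(level_conj (m := m) (S := invmx S) (s := s^-1%g)).
rewrite csg_conjK /conjm invmxK det_inv S1 invr1 !mulmxA.
rewrite mulVmx ?SL_unit// mul1mx mulmxKV ?SL_unit//.
by apply=> //; exact: actsV.
Qed.

Section Limit.
Variables (I : set nat) (H : closed_subgroup G).
Hypothesis I_inf : forall N, exists2 m, I m & (N <= m)%N.

(** An element of [H] belongs to K_m for arbitrarily large m, hence is 1. *)
Lemma level_trivial :
  (forall m, I m -> forall A, level m H A -> A = 1%:M) -> H = csg_trivial G.
Proof.
move=> triv; apply: csgP; apply/seteqP; split=> [h Hh|_ ->]; last exact: csg1.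
have [m0 dec] := G_decomp h.
have hK m : I m -> (m0 <= m)%N -> exists2 q, K m q & h = iota q.
  move=> Im /dec[A [s [q [A1 sA q1 hE]]]]; exists q => //.
  have A1' : A = 1%:M by apply: (triv m Im); split=> //; exists s, q; rewrite -hE.
  rewrite A1' in sA; by rewrite hE (acts_inj sA (acts1 m)) mul1g.
have [m Im m0m] := I_inf m0; have [q _ hE] := hK m Im m0m.
suff -> : h = 1%g by [].
suff q1 : q = 1%g by rewrite hE q1 iota_prod1.
apply: bp_eq; apply/functional_extensionality_dep => n.
have [k Ik] := I_inf (maxn m0 n.+1); rewrite geq_max => /andP[m0k nk].
by have [r r1] := hK k Ik m0k; rewrite hE => /iota_prod_inj ->; apply: r1.
Qed.

(** For arbitrarily large m, [H] meets every coset of K_m in SL(d m, Q) K_m: it is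
    dense. *)
Lemma level_full :
  (forall m, I m -> forall A, \det A = 1 -> level m H A) -> H = csg_full G.
Proof.
move=> full; apply: csgP; apply/seteqP; split=> // g _.
apply: csg_closed => U /G_nbhs[N NU]; have [m0 dec] := G_decomp g.
have [m Im] := I_inf (maxn m0 N); rewrite geq_max => /andP[/dec[A [s [p [A1 sA p1 gE]]]] Nm].
have [_ [s' [q [s'A q1 Hsq]]]] := full m Im A A1.
exists (s' * iota q)%g; split=> //.
have -> : (s' * iota q)%g = (g * iota (p^-1 * q))%g.
  by rewrite gE (acts_inj s'A sA) -mulgA -iota_prodM mulVKg.
apply: NU => n nN; have := cyl1M (cyl1V p1) q1; apply; exact: leq_trans Nm.
Qed.

(** A trivial trace at level m' puts the elements of [H] at the lower level m in
    K_m', hence in K_m, where their matrices are trivial. *)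
Lemma level_nontrivial m m' A : (m <= m')%N -> level m H A -> A != 1%:M ->
  ~ (forall B, level m' H B -> B = 1%:M).
Proof.
move=> mm' [A1 [s [q [sA q1 Hs]]]] /eqP nA triv; apply: nA.
have [B B1 sB] := acts_widen mm' A1 sA.
have [C [t [r [C1 tC r1 qE]]]] := iota_decomp q m'.
have BC : B *m C = 1%:M.
  apply: triv; split; first by rewrite det_mulmx B1 C1 mulr1.
  exists (s * t)%g, r; split=> //; first exact: actsM.
  by rewrite -mulgA -qE.
have st : (s * t = 1)%g.
  by apply: (@acts_inj m' 1%:M); [rewrite -BC; exact: actsM|exact: acts1].
have sE : s = iota (r * q^-1)%g.
  by rewrite iota_prodM iota_prodV qE invgM mulVKg; apply: (mulIg t); rewrite st mulVg.
rewrite sE in sA; apply: (acts_iota sA); apply: cyl1M; last exact: cyl1V.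
by move=> n nm; apply: r1; exact: leq_trans mm'.
Qed.

End Limit.
End LevelStructure.
Arguments level {d d_incr D} m H.

(** * Invariant random subgroups *)

Theorem proposition5p5 (R : realType) (d : nat -> nat)
  (d_incr : {homo d : m n / (m < n)%N})
  (d_odd : infinite_set [set n : nat | odd (d n)])
  (D : forall n : nat, finite_SL_subgroup (d n.+1 - d n)) :
  no_nontrivial_IRS (Ggroup d_incr D) R.
Proof.
move=> mu irs.
pose I : set nat := [set m | odd (d m) /\ (4 < d m)%N].
have I_inf N : exists2 m, I m & (N <= m)%N.
  apply: contrapT => none; apply: d_odd.
  apply: (@sub_finite_set _ _ `I_(maxn N 5)); last exact: finite_II.
  move=> m /= modd; rewrite ltnNge geq_max; apply/negP => /andP[Nm m5]; apply: none.
  by exists m => //; split=> //; exact: leq_trans (d_ge d_incr m).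
pose G := Ggroup d_incr D.
(* The event that the subgroup is trivial, in a form that is visibly measurable. *)
pose T : set (SubG G) := [set H | forall m A, level m (H : closed_subgroup G) A -> A = 1%:M].
have TE (H : SubG G) : T H <-> H = csg_trivial G :> closed_subgroup G.
  split=> [TH|-> m A [A1 [g [q [gA q1 /= gq]]]]].
    by apply: (level_trivial I_inf) => m _; exact: TH.
  have gE : g = iota_prod d_incr q^-1%g.
    by rewrite iota_prodV; apply: (mulIg (iota_prod d_incr q)); rewrite gq mulVg.
  by rewrite gE in gA; apply: (acts_iota gA); exact: cyl1V.
have mT : measurable T.
  apply: measurable_forall => m; apply: measurable_forall => A.
  rewrite (_ : mkset _ = ~` [set H | level m (H : closed_subgroup G) A /\ A <> 1%:M]).
    apply: measurableC; have [A1|A1] := pselect (A = 1%:M).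
      by rewrite (_ : mkset _ = set0)//; apply/seteqP; split=> // H [].
    rewrite (_ : mkset _ = [set H | level m (H : closed_subgroup G) A]).
      exact: measurable_level.
    by apply/seteqP; split=> H [].
  apply/seteqP; split=> H /=; rewrite not_andE; last by case=> // /contrapT.
  move=> HA; have [/HA|] := pselect (level m (H : closed_subgroup G) A).
    by right; apply.
  by left.
have dich : {ae mu, forall H : SubG G, H = csg_trivial G :> closed_subgroup G \/
    H = csg_full G :> closed_subgroup G}.
  have : {ae mu, forall H : SubG G, forall m, I m ->
     (forall A, level m (H : closed_subgroup G) A -> A = 1%:M) \/
     (forall A, \det A = 1 -> level m (H : closed_subgroup G) A)}.
    apply: ae_foralln => m; have [[modd m5]|nI] := pselect (I m); last by apply: aeW.
    have := random_SL_subgroup_dichotomy (level_random m irs) m5 modd.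
    by apply: filterS => H + _.
  apply: filterS => H Hd.
  have [triv|/existsNP[m /not_implyP[Im nontriv]]] := pselect (forall m, I m ->
      forall A, level m (H : closed_subgroup G) A -> A = 1%:M).
    by left; exact: (level_trivial I_inf).
  right; have [A HA A1] : exists2 A, level m (H : closed_subgroup G) A & A != 1%:M.
    apply: contrapT => none; apply: nontriv => A HA; apply/eqP/negPn/negP => A1.
    by apply: none; exists A.
  apply: (@level_full _ _ _ [set k | I k /\ (m <= k)%N]) => [N|k [Ik mk]].
    have [k Ik] := I_inf (maxn N m); rewrite geq_max => /andP[Nk mk].
    by exists k.
  have [triv|//] := Hd k Ik.
  by case: (level_nontrivial mk HA A1).
have fT : mu T \is a fin_num by exact: fin_num_measure.
exists (fine (mu T)).
  by rewrite fine_ge0 ?measure_ge0//= -lee_fin fineK// probability_le1.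
move=> A mA; rewrite EFinB fineK// !diracE.
have mTC : measurable (~` T) by exact: measurableC.
have [tA|tA] := pselect (A (csg_trivial G)); have [fA|fA] := pselect (A (csg_full G)).
- rewrite !mem_set//= !mule1 addeC subeK//.
  rewrite -(probability_setT mu); apply: measure_ae_eq => //.
  by apply: filterS dich => H [] ->.
- rewrite mem_set// memNset//= mule1 mule0 adde0; apply: measure_ae_eq => //.
  apply: filterS dich => H HH; rewrite TE; case: HH => HE; last first.
    by split=> [AH|HT]; [case: fA; rewrite -HE|case: fA; rewrite -HE HT].
  by rewrite HE; split.
- rewrite memNset// mem_set//= mule1 mule0 add0e -probability_setC//.
  apply: measure_ae_eq => //; apply: filterS dich => H HH; rewrite /setC /= TE.
  case: HH => HE; first by rewrite HE; split=> // /(_ erefl).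
  by rewrite HE; split=> // _ ft; apply: tA; rewrite -ft.
- rewrite !memNset//= !mule0 adde0 -(measure0 mu); apply: measure_ae_eq => //.
  by apply: filterS dich => H [] ->; split.
Qed.
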